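(* Let $\mathcal{H}$ be a hereditary abelian category, $T$ a basic tilting object in $\mathcal{H}$ (so that $T$ is also a tilting object in the cluster category $\mathcal{C}(\mathcal{H})$), $A=\mathrm{End}_{\mathcal{H}}(T)$ the quasi-tilted algebra and $\Lambda=\mathrm{End}_{\mathcal{C}(\mathcal{H})}(T)$ the cluster-tilted algebra of $T$. Then $$\Lambda\cong A\ltimes D\,\mathrm{Hom}_{\mathcal{H}}(T,\tau^2T),$$ i.e. $\Lambda$ is the trivial extension of $A$ by the $A$-bimodule $D\,\mathrm{Hom}_{\mathcal{H}}(T,\tau^2T)$.
   Context: $K$ is a field and $D=\mathrm{Hom}_K(-,K)$. Hereditary abelian categories $\mathcal{H}$ are $K$-categories with finite-dimensional Hom- and Ext-spaces. An object $T$ of $\mathcal{H}$ is a tilting object if $\mathrm{Ext}^1_{\mathcal{H}}(T,T)=0$ and every object $X$ with $\mathrm{Hom}_{\mathcal{H}}(T,X)=\mathrm{Ext}^1_{\mathcal{H}}(T,X)=0$ is zero. ''Basic'' means multiplicity-free. $D^b(\mathcal{H})$ is the bounded derived category, with shift $[1]$ and Auslander-Reiten translation $\tau$; $\mathcal{H}$ is identified with the complexes concentrated in degree $0$. The cluster category $\mathcal{C}(\mathcal{H})$ is the orbit category $D^b(\mathcal{H})/F$ with $F=\tau^{-1}[1]$: its objects are the $F$-orbits of objects of $D^b(\mathcal{H})$, and $\mathrm{Hom}_{\mathcal{C}(\mathcal{H})}(X,Y)=\bigoplus_{i\in\mathbf{Z}}\mathrm{Hom}_{D^b(\mathcal{H})}(X,F^iY)$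 with the natural composition. In $\mathrm{Hom}_{\mathcal{H}}(T,\tau^2T)$, $\tau$ is the Auslander-Reiten translation of $\mathcal{H}$, which on an indecomposable $X$ agrees with $\tau$ of $D^b(\mathcal{H})$ when the result lies in $\mathcal{H}$, and is $0$ if $X$ is projective; one has $\mathrm{Hom}_{\mathcal{H}}(T,\tau^2T)=\mathrm{Hom}_{D^b(\mathcal{H})}(T,\tau^2T)$. Its $A$-bimodule structure is given by the action of $A=\mathrm{End}(T)$ on the first argument and, on the second argument, by the action of $A\cong\mathrm{End}_{D^b(\mathcal{H})}(\tau^2T)$ (via the autoequivalence $\tau^2$ of $D^b(\mathcal{H})$). For an algebra $A$ and an $A$-bimodule $M$, the trivial extension $A\ltimes M$ consists of pairs $(a,m)$, $a\in A$, $m\in M$, with componentwise addition and multiplication $(a,m)(b,n)=(ab,an+mb)$. *)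

(* Defs.v *)
From HB Require Import structures.
From mathcomp Require Import all_boot all_order all_algebra.
From mathcomp Require Import zify.
From mathcomp Require Import boolp classical_sets functions cardinality fsbigop.

Set Implicit Arguments.
Unset Strict Implicit.
Unset Printing Implicit Defensive.
Import GRing.Theory.
Local Open Scope ring_scope.

Definition findim (K : fieldType) (V : lmodType K) : Prop :=
  exists (n : nat) (f : {linear 'rV[K]_n -> V}), forall v, exists x, f x = v.

Definition dprod (R : pzRingType) (I : Type) (V : I -> lmodType R) : Type :=
  forall i, V i.

Section Dprod.
Variables (R : pzRingType) (I : Type) (V : I -> lmodType R).
Local Notation P := (dprod V).
Implicit Types (f g h : P) (a b : R).

HB.instance Definition _ := gen_eqMixin P.
HB.instance Definition _ := gen_choiceMixin P.

Definition dprod_zero : P := fun i => 0.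
Definition dprod_opp f : P := fun i => - f i.
Definition dprod_add f g : P := fun i => f i + g i.
Definition dprod_scale a f : P := fun i => a *: f i.

Fact dprod_addA : associative dprod_add.
Proof. by move=> f g h; apply: functional_extensionality_dep => i; apply: addrA. Qed.
Fact dprod_addC : commutative dprod_add.
Proof. by move=> f g; apply: functional_extensionality_dep => i; apply: addrC. Qed.
Fact dprod_add0 : left_id dprod_zero dprod_add.
Proof. by move=> f; apply: functional_extensionality_dep => i; apply: add0r. Qed.
Fact dprod_addN : left_inverse dprod_zero dprod_opp dprod_add.
Proof. by move=> f; apply: functional_extensionality_dep => i; apply: addNr. Qed.

HB.instance Definition _ :=
  GRing.isZmodule.Build P dprod_addA dprod_addC dprod_add0 dprod_addN.

Fact dprod_scaleA a b f :
  dprod_scale a (dprod_scale b f) = dprod_scale (a * b) f.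
Proof. by apply: functional_extensionality_dep => i; apply: scalerA. Qed.
Fact dprod_scale1 : left_id 1 dprod_scale.
Proof. by move=> f; apply: functional_extensionality_dep => i; apply: scale1r. Qed.
Fact dprod_scaleDr : right_distributive dprod_scale +%R.
Proof. by move=> a f g; apply: functional_extensionality_dep => i; apply: scalerDr. Qed.
Fact dprod_scaleDl f : {morph dprod_scale^~ f : a b / a + b}.
Proof. by move=> a b; apply: functional_extensionality_dep => i; apply: scalerDl. Qed.

HB.instance Definition _ := GRing.Zmodule_isLmodule.Build R P
  dprod_scaleA dprod_scale1 dprod_scaleDr dprod_scaleDl.

Lemma dprodP f g : (forall i, f i = g i) -> f = g.
Proof. exact: functional_extensionality_dep. Qed.
Lemma dprodDE f g i : (f + g) i = f i + g i. Proof. by []. Qed.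
Lemma dprod0E i : (0 : P) i = 0. Proof. by []. Qed.
Lemma dprodZE a f i : (a *: f) i = a *: f i. Proof. by []. Qed.
End Dprod.

Section Dsum.
Variables (R : pzRingType) (I : eqType) (V : I -> lmodType R).

Definition finsupp_pred : {pred dprod V} :=
  fun f => `[< exists s : seq I, forall i, i \notin s -> f i = 0 >].

Fact finsupp_closed : submod_closed finsupp_pred.
Proof.
split; first by apply/asboolP; exists [::].
move=> a f g /asboolP[s sP] /asboolP[t tP]; apply/asboolP; exists (s ++ t) => i.
rewrite mem_cat negb_or => /andP[/sP fi /tP gi].
by rewrite dprodDE dprodZE fi gi scaler0 addr0.
Qed.
HB.instance Definition _ :=
  GRing.isSubmodClosed.Build R (dprod V) finsupp_pred finsupp_closed.

Record dsum := Dsum { dsum_val : dprod V; dsumP : dsum_val \in finsupp_pred }.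
HB.instance Definition _ := [isSub for dsum_val].
HB.instance Definition _ := [Choice of dsum by <:].
HB.instance Definition _ := [SubChoice_isSubLmodule of dsum by <:].
Definition dsum_fun (f : dsum) i : V i := dsum_val f i.
Coercion dsum_fun : dsum >-> Funclass.
End Dsum.

Section Dual.
Variables (R : comPzRingType) (V : lmodType R).
Local Notation fam := (dprod (fun _ : V => R^o)).

Definition scalar_pred : {pred fam} :=
  fun f => `[< scalar (f : V -> R) >].

Fact scalar_closed : submod_closed scalar_pred.
Proof.
split; first by apply/asboolP => a u v; rewrite !dprod0E mulr0 addr0.
move=> a f g /asboolP fP /asboolP gP; apply/asboolP => b u v.
rewrite !dprodDE !dprodZE fP gP /= scalerDr mulrDr addrACA; congr (_ + _ + _).
exact: mulrCA.
Qed.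
HB.instance Definition _ :=
  GRing.isSubmodClosed.Build R fam scalar_pred scalar_closed.

Record dual := Dual { dual_val : fam; dualP : dual_val \in scalar_pred }.
HB.instance Definition _ := [isSub for dual_val].
HB.instance Definition _ := [Choice of dual by <:].
HB.instance Definition _ := [SubChoice_isSubLmodule of dual by <:].
Definition dual_fun (f : dual) v : R := dual_val f v.
Coercion dual_fun : dual >-> Funclass.

Lemma dual_scalar (f : dual) : scalar f.
Proof. by apply/asboolP; apply: dualP. Qed.

Lemma dualDE (f g : dual) v : (f + g) v = f v + g v.
Proof. by []. Qed.
Lemma dualZE a (f : dual) v : (a *: f) v = a * f v.
Proof. by []. Qed.
Lemma dual_eq (f g : dual) : (forall v, f v = g v) -> f = g.
Proof. by move=> fg; apply/val_inj/dprodP. Qed.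

Definition dual_mk (f : V -> R) (fP : scalar f) : dual :=
  Dual (asboolT fP : (f : fam) \in scalar_pred).
End Dual.

Record lincat (K : fieldType) := LinCat {
  obj :> Type;
  mor : obj -> obj -> lmodType K;
  idm : forall X, mor X X;
  cmp : forall X Y Z, mor Y Z -> mor X Y -> mor X Z;
  comp_linearl : forall X Y Z (f : mor X Y), linear (fun g : mor Y Z => cmp g f);
  comp_linearr : forall X Y Z (g : mor Y Z), linear (fun f : mor X Y => cmp g f);
  compA : forall X Y Z W (h : mor Z W) (g : mor Y Z) (f : mor X Y),
    cmp h (cmp g f) = cmp (cmp h g) f;
  comp1m : forall X Y (f : mor X Y), cmp (idm Y) f = f;
  compm1 : forall X Y (f : mor X Y), cmp f (idm X) = f }.

Arguments mor {K l} X Y.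
Arguments idm {K l} X.
Arguments cmp {K l X Y Z} g f.

Notation "g \oc f" := (cmp g f) (at level 40, left associativity).

Section LincatTheory.
Variables (K : fieldType) (C : lincat K).
Implicit Types X Y Z : C.

Lemma compDl X Y Z (g g' : mor Y Z) (f : mor X Y) :
  (g + g') \oc f = g \oc f + g' \oc f.
Proof. by have := comp_linearl f 1 g g'; rewrite !scale1r. Qed.
Lemma compDr X Y Z (g : mor Y Z) (f f' : mor X Y) :
  g \oc (f + f') = g \oc f + g \oc f'.
Proof. by have := comp_linearr g 1 f f'; rewrite !scale1r. Qed.
Lemma comp0m X Y Z (f : mor X Y) : (0 : mor Y Z) \oc f = 0.
Proof. by apply: (addrI (0 \oc f)); rewrite -compDl !addr0. Qed.
Lemma compm0 X Y Z (g : mor Y Z) : g \oc (0 : mor X Y) = 0.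
Proof. by apply: (addrI (g \oc 0)); rewrite -compDr !addr0. Qed.
Lemma compZl X Y Z a (g : mor Y Z) (f : mor X Y) : (a *: g) \oc f = a *: (g \oc f).
Proof. by have := comp_linearl f a g 0; rewrite !addr0 comp0m addr0. Qed.
Lemma compZr X Y Z a (g : mor Y Z) (f : mor X Y) : g \oc (a *: f) = a *: (g \oc f).
Proof. by have := comp_linearr g a f 0; rewrite !addr0 compm0 addr0. Qed.
Lemma compNl X Y Z (g : mor Y Z) (f : mor X Y) : (- g) \oc f = - (g \oc f).
Proof. by rewrite -!scaleN1r compZl. Qed.
Lemma compNr X Y Z (g : mor Y Z) (f : mor X Y) : g \oc (- f) = - (g \oc f).
Proof. by rewrite -!scaleN1r compZr. Qed.
Lemma comp_sumr X Y Z (g : mor Y Z) (I : Type) (s : seq I) (F : I -> mor X Y) :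
  g \oc (\sum_(i <- s) F i) = \sum_(i <- s) g \oc F i.
Proof. by apply: (big_morph (cmp g)); [apply: compDr | apply: compm0]. Qed.
Lemma comp_suml X Y Z (f : mor X Y) (I : Type) (s : seq I) (F : I -> mor Y Z) :
  (\sum_(i <- s) F i) \oc f = \sum_(i <- s) F i \oc f.
Proof.
by apply: (big_morph (fun g => g \oc f)); [move=> g g'; apply: compDl | apply: comp0m].
Qed.

Definition is_iso X Y (f : mor X Y) : Prop :=
  exists g : mor Y X, g \oc f = idm X /\ f \oc g = idm Y.
Definition iso X Y : Prop := exists f : mor X Y, is_iso f.
Definition is_mono X Y (f : mor X Y) : Prop :=
  forall W (u v : mor W X), f \oc u = f \oc v -> u = v.
Definition is_epi X Y (f : mor X Y) : Prop :=
  forall W (u v : mor Y W), u \oc f = v \oc f -> u = v.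
Definition is_kernel X Y W (f : mor X Y) (k : mor W X) : Prop :=
  f \oc k = 0 /\
  forall V (u : mor V X), f \oc u = 0 -> exists! v : mor V W, k \oc v = u.
Definition is_cokernel X Y W (f : mor X Y) (q : mor Y W) : Prop :=
  q \oc f = 0 /\
  forall V (u : mor Y V), u \oc f = 0 -> exists! v : mor W V, v \oc q = u.

Definition is_zero X : Prop := idm X = 0.
(* Z, not X, is the direct sum of the other two *)
Definition is_sum X Y Z : Prop :=
  exists (i : mor X Z) (j : mor Y Z) (p : mor Z X) (q : mor Z Y),
    [/\ p \oc i = idm X, q \oc j = idm Y, p \oc j = 0, q \oc i = 0
      & i \oc p + j \oc q = idm Z].
Definition is_summand X Z : Prop := exists Y, is_sum X Y Z.
Definition indecomposable X : Prop :=
  ~ is_zero X /\ forall Y Z, is_sum Y Z X -> is_zero Y \/ is_zero Z.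
Definition projective P : Prop :=
  forall X Y (p : mor X Y) (f : mor P Y), is_epi p -> exists g, p \oc g = f.
Definition basic T : Prop :=
  forall X XX, indecomposable X -> is_sum X X XX -> ~ is_summand XX T.
End LincatTheory.

Record abcat (K : fieldType) := AbCat {
  ab_cat :> lincat K;
  zero_ob : ab_cat;
  zero_obP : is_zero zero_ob;
  ab_sum : forall X Y : ab_cat, exists Z, is_sum X Y Z;
  ab_ker : forall (X Y : ab_cat) (f : mor X Y),
    exists W (k : mor W X), is_kernel f k;
  ab_coker : forall (X Y : ab_cat) (f : mor X Y),
    exists W (q : mor Y W), is_cokernel f q;
  ab_mono : forall (X Y : ab_cat) (f : mor X Y), is_mono f ->
    exists W (g : mor Y W), is_kernel g f;
  ab_epi : forall (X Y : ab_cat) (f : mor X Y), is_epi f ->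
    exists W (g : mor W X), is_cokernel g f }.

Record functor (K : fieldType) (C D : lincat K) := Functor {
  fob :> C -> D;
  fmap : forall X Y, mor X Y -> mor (fob X) (fob Y);
  fmap_linear : forall X Y, linear (@fmap X Y);
  fmap1 : forall X, fmap (idm X) = idm (fob X);
  fmapM : forall X Y Z (g : mor Y Z) (f : mor X Y),
    fmap (g \oc f) = fmap g \oc fmap f }.
Arguments fmap {K C D} f {X Y} _ : rename.

Section FunctorTheory.
Variable K : fieldType.

Lemma fmapD (C D : lincat K) (F : functor C D) X Y (f g : mor X Y) :
  fmap F (f + g) = fmap F f + fmap F g.
Proof. by have := fmap_linear F 1 f g; rewrite !scale1r. Qed.
Lemma fmap0 (C D : lincat K) (F : functor C D) X Y : fmap F (0 : mor X Y) = 0.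
Proof. by apply: (addrI (fmap F 0)); rewrite -fmapD !addr0. Qed.
Lemma fmapZ (C D : lincat K) (F : functor C D) X Y a (f : mor X Y) :
  fmap F (a *: f) = a *: fmap F f.
Proof. by have := fmap_linear F a f 0; rewrite !addr0 fmap0 addr0. Qed.
Lemma fmap_sum (C D : lincat K) (F : functor C D) X Y (I : Type) (s : seq I)
    (f : I -> mor X Y) :
  fmap F (\sum_(i <- s) f i) = \sum_(i <- s) fmap F (f i).
Proof. by apply: big_morph; [apply: fmapD | apply: fmap0]. Qed.

Definition fid (C : lincat K) : functor C C :=
  @Functor K C C id (fun _ _ f => f) (fun _ _ _ _ _ => erefl)
    (fun _ => erefl) (fun _ _ _ _ _ => erefl).

Section Comp.
Variables (C D E : lincat K) (G : functor D E) (F : functor C D).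
Fact fcomp_linear X Y : linear (fun f : mor X Y => fmap G (fmap F f)).
Proof. by move=> a u v; rewrite !fmap_linear. Qed.
Fact fcomp1 X : fmap G (fmap F (idm X)) = idm (G (F X)).
Proof. by rewrite !fmap1. Qed.
Fact fcompM X Y Z (g : mor Y Z) (f : mor X Y) :
  fmap G (fmap F (g \oc f)) = fmap G (fmap F g) \oc fmap G (fmap F f).
Proof. by rewrite !fmapM. Qed.
Definition fcomp : functor C E := Functor fcomp_linear fcomp1 fcompM.
End Comp.

Definition natural (C D : lincat K) (F G : functor C D)
    (a : forall X, mor (F X) (G X)) : Prop :=
  forall X Y (f : mor X Y), a Y \oc fmap F f = fmap G f \oc a X.

Definition fiso (C D : lincat K) (F G : functor C D) : Prop :=
  exists a : forall X, mor (F X) (G X), natural a /\ forall X, is_iso (a X).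

Record autoequiv (C : lincat K) := Autoequiv {
  ae :> functor C C;
  ae_inv : functor C C;
  ae_unit : fiso (fid C) (fcomp ae_inv ae);
  ae_counit : fiso (fcomp ae ae_inv) (fid C) }.

(* S is a Serre functor: Hom(X, Y) ~ D Hom(Y, S X), naturally in X and Y. *)
Definition is_serre (C : lincat K) (S : functor C C) : Prop :=
  exists phi : forall X Y : C, mor X Y -> dual (mor Y (S X)),
  [/\ forall X Y, linear (@phi X Y) /\ bijective (@phi X Y),
      forall X Y Z (g : mor Y Z) (f : mor X Y) (h : mor Z (S X)),
        phi X Z (g \oc f) h = phi X Y f (h \oc g)
    & forall W X Y (f : mor X Y) (e : mor W X) (h : mor Y (S W)),
        phi W Y (f \oc e) h = phi X Y f (fmap S e \oc h)].
End FunctorTheory.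

Record cplx (K : fieldType) (H : abcat K) := Cplx {
  cx :> int -> H;
  cd : forall i : int, mor (cx i) (cx (i + 1));
  cdd : forall i, cd (i + 1) \oc cd i = 0;
  cx_bounded : exists n : nat, forall i : int, (n < `|i|)%N -> is_zero (cx i) }.
Arguments cd {K H} c i.

Section ChainMaps.
Variables (K : fieldType) (H : abcat K).
Implicit Types X Y Z : cplx H.

Section Hom.
Variables X Y : cplx H.
Local Notation fam := (dprod (fun i : int => mor (X i) (Y i))).
Definition chain_pred : {pred fam} :=
  fun f => `[< forall i, cd Y i \oc f i = f (i + 1) \oc cd X i >].

Fact chain_closed : submod_closed chain_pred.
Proof.
split; first by apply/asboolP => i; rewrite !dprod0E compm0 comp0m.
move=> a f g /asboolP fP /asboolP gP; apply/asboolP => i.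
by rewrite !dprodDE !dprodZE compDl compDr compZl compZr fP gP.
Qed.
HB.instance Definition _ :=
  GRing.isSubmodClosed.Build K fam chain_pred chain_closed.

Record chain := Chain { chain_val : fam; chainP : chain_val \in chain_pred }.
HB.instance Definition _ := [isSub for chain_val].
HB.instance Definition _ := [Choice of chain by <:].
HB.instance Definition _ := [SubChoice_isSubLmodule of chain by <:].
Definition chain_fun (f : chain) i : mor (X i) (Y i) := chain_val f i.
Coercion chain_fun : chain >-> Funclass.

Lemma chainDE (f g : chain) i : (f + g) i = f i + g i. Proof. by []. Qed.
Lemma chainZE a (f : chain) i : (a *: f) i = a *: f i. Proof. by []. Qed.
Lemma chain_eq (f g : chain) : (forall i, f i = g i) -> f = g.
Proof. by move=> fg; apply/val_inj/dprodP. Qed.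
Lemma chain_comm (f : chain) i : cd Y i \oc f i = f (i + 1) \oc cd X i.
Proof. by move: i; apply/asboolP; apply: chainP. Qed.
Definition chain_mk (f : forall i : int, mor (X i) (Y i))
    (fP : forall i, cd Y i \oc f i = f (i + 1) \oc cd X i) : chain :=
  Chain (asboolT fP : (f : fam) \in chain_pred).
End Hom.

Fact chain_id_comm X i : cd X i \oc idm (X i) = idm (X (i + 1)) \oc cd X i.
Proof. by rewrite compm1 comp1m. Qed.
Definition chain_id X : chain X X := chain_mk (chain_id_comm X).

Fact chain_comp_comm X Y Z (g : chain Y Z) (f : chain X Y) i :
  cd Z i \oc (g i \oc f i) = (g (i + 1) \oc f (i + 1)) \oc cd X i.
Proof. by rewrite compA chain_comm -compA chain_comm compA. Qed.
Definition chain_comp X Y Z (g : chain Y Z) (f : chain X Y) : chain X Z :=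
  chain_mk (chain_comp_comm g f).

Fact chain_comp_linearl X Y Z (f : chain X Y) :
  linear (fun g : chain Y Z => chain_comp g f).
Proof.
by move=> a u v; apply: chain_eq => i; rewrite chainDE chainZE; apply: comp_linearl.
Qed.
Fact chain_comp_linearr X Y Z (g : chain Y Z) :
  linear (fun f : chain X Y => chain_comp g f).
Proof.
by move=> a u v; apply: chain_eq => i; rewrite chainDE chainZE; apply: comp_linearr.
Qed.
Fact chain_compA X Y Z W (h : chain Z W) (g : chain Y Z) (f : chain X Y) :
  chain_comp h (chain_comp g f) = chain_comp (chain_comp h g) f.
Proof. by apply: chain_eq => i; apply: compA. Qed.
Fact chain_comp1m X Y (f : chain X Y) : chain_comp (chain_id Y) f = f.
Proof. by apply: chain_eq => i; apply: comp1m. Qed.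
Fact chain_compm1 X Y (f : chain X Y) : chain_comp f (chain_id X) = f.
Proof. by apply: chain_eq => i; apply: compm1. Qed.

Definition cplx_cat : lincat K :=
  @LinCat K (cplx H) (fun X Y => chain X Y) chain_id chain_comp
    chain_comp_linearl chain_comp_linearr chain_compA chain_comp1m chain_compm1.

Definition homotopic X Y (f g : chain X Y) : Prop :=
  exists h : forall i : int, mor (X (i + 1)) (Y i),
    forall i, f (i + 1) - g (i + 1) = cd Y i \oc h i + h (i + 1) \oc cd X (i + 1).

(* The cohomology of X in degree i + 1: cycles, and cycles modulo boundaries. *)
Record cohomology X (i : int) := Cohomology {
  cyc : H;
  cyc_in : mor cyc (X (i + 1));
  cyc_bd : mor (X i) cyc;
  coh : H;
  coh_pr : mor cyc coh;
  cyc_inP : is_kernel (cd X (i + 1)) cyc_in;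
  cyc_bdP : cyc_in \oc cyc_bd = cd X i;
  coh_prP : is_cokernel cyc_bd coh_pr }.

Definition quasi_iso X Y (f : chain X Y) : Prop :=
  forall i (hX : cohomology X i) (hY : cohomology Y i)
    (z : mor (cyc hX) (cyc hY)) (c : mor (coh hX) (coh hY)),
    cyc_in hY \oc z = f (i + 1) \oc cyc_in hX ->
    c \oc coh_pr hX = coh_pr hY \oc z -> is_iso c.

(* The shift X[1], with X[1]^i = X^(i+1) and differential - d. *)
Fact shift_dd X i : (- cd X (i + 1 + 1)) \oc (- cd X (i + 1)) = 0.
Proof. by rewrite compNl compNr opprK cdd. Qed.
Fact shift_bounded X :
  exists n : nat, forall i : int, (n < `|i|)%N -> is_zero (X (i + 1)).
Proof.
have [n nP] := cx_bounded X; exists n.+1 => i ni; apply: nP.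
by move: ni; case: i => i; lia.
Qed.
Definition shift_ob X : cplx H :=
  @Cplx K H (fun i => X (i + 1)) (fun i => - cd X (i + 1)) (shift_dd X)
    (shift_bounded X).
Fact shift_comm X Y (f : chain X Y) i :
  (- cd Y (i + 1)) \oc f (i + 1) = f (i + 1 + 1) \oc (- cd X (i + 1)).
Proof. by rewrite compNl compNr chain_comm. Qed.
Definition shift_map X Y (f : chain X Y) : chain (shift_ob X) (shift_ob Y) :=
  @chain_mk (shift_ob X) (shift_ob Y) (fun i => f (i + 1)) (shift_comm f).
Fact shift_linear X Y : linear (@shift_map X Y).
Proof. by move=> a u v; apply: chain_eq. Qed.
Fact shift_id X : shift_map (chain_id X) = chain_id (shift_ob X).
Proof. exact: chain_eq. Qed.
Fact shift_compM X Y Z (g : chain Y Z) (f : chain X Y) :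
  shift_map (chain_comp g f) = chain_comp (shift_map g) (shift_map f).
Proof. exact: chain_eq. Qed.
Definition cplx_shift : functor cplx_cat cplx_cat :=
  @Functor K cplx_cat cplx_cat shift_ob shift_map shift_linear shift_id shift_compM.

Definition stalk_cx (X : H) (i : int) : H := if i is Posz 0 then X else zero_ob H.
Fact stalk_dd (X : H) (i : int) :
  (0 : mor (stalk_cx X (i + 1)) (stalk_cx X (i + 1 + 1)))
    \oc (0 : mor (stalk_cx X i) (stalk_cx X (i + 1))) = 0.
Proof. exact: comp0m. Qed.
Fact stalk_bounded (X : H) :
  exists n : nat, forall i : int, (n < `|i|)%N -> is_zero (stalk_cx X i).
Proof. by exists 0%N => -[[|i]|i] //= _; apply: zero_obP. Qed.
Definition stalk_ob (X : H) : cplx H := Cplx (stalk_dd X) (stalk_bounded X).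
Definition stalk_fun (X Y : H) (f : mor X Y) (i : int) :
    mor (stalk_cx X i) (stalk_cx Y i) :=
  if i is Posz 0 then f else 0.
Fact stalk_comm (X Y : H) (f : mor X Y) i :
  (0 : mor (stalk_cx Y i) (stalk_cx Y (i + 1))) \oc stalk_fun f i
  = stalk_fun f (i + 1) \oc 0.
Proof. by rewrite comp0m compm0. Qed.
Definition stalk_map (X Y : H) (f : mor X Y) : chain (stalk_ob X) (stalk_ob Y) :=
  @chain_mk (stalk_ob X) (stalk_ob Y) (stalk_fun f) (stalk_comm f).
Fact stalk_linear (X Y : H) : linear (@stalk_map X Y).
Proof.
move=> a u v; apply: chain_eq => i; rewrite chainDE chainZE.
by case: i => [[|i]|i] //; rewrite /chain_fun /= scaler0 addr0.
Qed.
Fact stalk_id (X : H) : stalk_map (idm X) = chain_id (stalk_ob X).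
Proof. by apply: chain_eq => -[[|i]|i] //=; rewrite /chain_fun /= [RHS]zero_obP. Qed.
Fact stalk_compM (X Y Z : H) (g : mor Y Z) (f : mor X Y) :
  stalk_map (g \oc f) = chain_comp (stalk_map g) (stalk_map f).
Proof. by apply: chain_eq => -[[|i]|i] //=; rewrite /chain_fun /= comp0m. Qed.
Definition stalk : functor H cplx_cat :=
  @Functor K H cplx_cat stalk_ob stalk_map stalk_linear stalk_id stalk_compM.
End ChainMaps.

(* [D] is the category of left fractions of the homotopy category K^b(H) with
   respect to the quasi-isomorphisms: up to isomorphism the objects are the
   bounded complexes, a morphism Q X -> Q Y is a fraction s^-1 f with
   f : X -> Z and s : Y -> Z a quasi-isomorphism, and Q f = Q g iff f and g
   become homotopic after composition with a quasi-isomorphism.  This determines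
   (D, Q) up to equivalence, and the shift up to isomorphism. *)
Record derived_cat (K : fieldType) (H : abcat K) := DerivedCat {
  dcat :> lincat K;
  dQ : functor (cplx_cat H) dcat;
  dQ_surj : forall M : dcat, exists X : cplx_cat H, iso (dQ X) M;
  dQ_qis : forall (X Y : cplx_cat H) (s : mor X Y),
    quasi_iso s -> is_iso (fmap dQ s);
  dQ_full : forall (X Y : cplx_cat H) (g : mor (dQ X) (dQ Y)),
    exists (Z : cplx_cat H) (f : mor X Z) (s : mor Y Z),
      quasi_iso s /\ fmap dQ s \oc g = fmap dQ f;
  dQ_eq : forall (X Y : cplx_cat H) (f g : mor X Y),
    fmap dQ f = fmap dQ g <->
    exists (Z : cplx_cat H) (s : mor Y Z),
      quasi_iso s /\ homotopic (s \oc f) (s \oc g);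
  dshift : functor dcat dcat;
  dshiftQ : fiso (fcomp dshift dQ) (fcomp dQ (cplx_shift H)) }.

Section Derived.
Variables (K : fieldType) (H : abcat K) (D : derived_cat H).

Definition incl : functor H D := fcomp (dQ D) (stalk H).

Definition Ext (n : nat) (X Y : H) : lmodType K :=
  mor (incl X) (iter n (dshift D) (incl Y)).

Definition hereditary : Prop :=
  [/\ forall n X Y (e : Ext n X Y), (2 <= n)%N -> e = 0,
      forall X Y : H, findim (mor X Y)
    & forall n X Y, findim (Ext n X Y)].

Definition tilting (T : H) : Prop :=
  (forall e : Ext 1 T T, e = 0) /\
  forall X : H, (forall f : mor T X, f = 0) -> (forall e : Ext 1 T X, e = 0) ->
    is_zero X.

(* The Auslander-Reiten translation of D^b(H) is the autoequivalence tau such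
   that tau [1] is the Serre functor. *)
Record ar_translation := ArTranslation {
  tau :> autoequiv D;
  tau_serre : is_serre (fcomp tau (dshift D)) }.

(* The Auslander-Reiten translation of H, on objects: additive, and determined on
   the indecomposable objects by tau. *)
Definition is_ar_translation_on (tau : ar_translation) (tauH : H -> H) : Prop :=
  [/\ forall X Y, iso X Y -> iso (tauH X) (tauH Y),
      forall X Y Z, is_sum X Y Z -> is_sum (tauH X) (tauH Y) (tauH Z),
      forall X, indecomposable X -> projective X -> is_zero (tauH X)
    & forall X Y, indecomposable X -> iso (incl Y) (tau (incl X)) ->
        iso (tauH X) Y].

Definition cluster_functor (tau : ar_translation) : functor D D :=
  fcomp (ae_inv tau) (dshift D).
End Derived.

(* The integer powers of an autoequivalence F, with coherent isomorphisms
   F^i F^j ~ F^(i+j) and 1 ~ F^0.  They exist and are unique up to coherent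
   isomorphism; when F is an automorphism of categories, the identities
   F^i F^j = F^(i+j) provide them.  The index k = i + j is kept as a variable to
   avoid transports along equalities in int. *)
Record int_powers (K : fieldType) (C : lincat K) (F : functor C C) := IntPowers {
  pw : int -> functor C C;
  pw_mu : forall i j k : int, i + j = k -> forall X, mor (pw i (pw j X)) (pw k X);
  pw_eps : forall X, mor X (pw 0 X);
  pw1 : fiso (pw 1) F;
  pw_mu_iso : forall i j k (e : i + j = k) X, is_iso (pw_mu e X);
  pw_mu_nat : forall i j k (e : i + j = k),
    natural (F := fcomp (pw i) (pw j)) (G := pw k) (pw_mu e);
  pw_eps_iso : forall X, is_iso (pw_eps X);
  pw_eps_nat : natural (F := fid C) (G := pw 0) pw_eps;
  pw_muA : forall i j k l m n (eij : i + j = l) (elk : l + k = n)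
      (ejk : j + k = m) (eim : i + m = n) X,
    pw_mu elk X \oc pw_mu eij (pw k X) = pw_mu eim X \oc fmap (pw i) (pw_mu ejk X);
  pw_mul1 : forall i (e : 0 + i = i) X, pw_mu e X \oc pw_eps (pw i X) = idm (pw i X);
  pw_mur1 : forall i (e : i + 0 = i) X,
    pw_mu e X \oc fmap (pw i) (pw_eps X) = idm (pw i X) }.

Section Orbit.
Variables (K : fieldType) (C : lincat K) (F : functor C C) (P : int_powers F).
Implicit Types X Y Z W : C.

Definition orbit_hom X Y : lmodType K := dsum (fun i : int => mor X (pw P i Y)).

Lemma orbit_eq X Y (f g : orbit_hom X Y) : (forall i, f i = g i) -> f = g.
Proof. by move=> fg; apply/val_inj/dprodP. Qed.
Lemma orbit_supp X Y (f : orbit_hom X Y) :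
  exists s : seq int, uniq s /\ forall i, i \notin s -> f i = 0.
Proof.
have /asboolP[s sP] := dsumP f; exists (undup s); split; first exact: undup_uniq.
by move=> i; rewrite mem_undup => /sP.
Qed.
Definition orbit_mk X Y (f : forall i : int, mor X (pw P i Y))
    (fP : exists s : seq int, forall i, i \notin s -> f i = 0) : orbit_hom X Y :=
  Dsum (asboolT fP : (f : dprod (fun i : int => mor X (pw P i Y))) \in
                       @finsupp_pred _ _ _).

Definition hcomp (i j k : int) (e : i + j = k) X Y Z
    (g : mor Y (pw P j Z)) (f : mor X (pw P i Y)) : mor X (pw P k Z) :=
  pw_mu P e Z \oc fmap (pw P i) g \oc f.

Section Hcomp.
Variables (i j k : int) (e : i + j = k).
Lemma hcomp0m X Y Z (f : mor X (pw P i Y)) : hcomp e (0 : mor Y (pw P j Z)) f = 0.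
Proof. by rewrite /hcomp fmap0 compm0 comp0m. Qed.
Lemma hcompm0 X Y Z (g : mor Y (pw P j Z)) : hcomp e g (0 : mor X (pw P i Y)) = 0.
Proof. exact: compm0. Qed.
Lemma hcomp_linearl X Y Z (f : mor X (pw P i Y)) :
  linear (fun g : mor Y (pw P j Z) => hcomp e g f).
Proof.
move=> a u v; rewrite /hcomp fmap_linear.
by rewrite comp_linearr compDl compZl.
Qed.
Lemma hcomp_linearr X Y Z (g : mor Y (pw P j Z)) :
  linear (fun f : mor X (pw P i Y) => hcomp e g f).
Proof. exact: comp_linearr. Qed.
Lemma hcomp_sumr X Y Z (g : mor Y (pw P j Z)) (I : Type) (s : seq I)
    (f : I -> mor X (pw P i Y)) :
  hcomp e g (\sum_(x <- s) f x) = \sum_(x <- s) hcomp e g (f x).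
Proof. exact: comp_sumr. Qed.
Lemma hcomp_suml X Y Z (f : mor X (pw P i Y)) (I : Type) (s : seq I)
    (g : I -> mor Y (pw P j Z)) :
  hcomp e (\sum_(x <- s) g x) f = \sum_(x <- s) hcomp e (g x) f.
Proof. by rewrite /hcomp fmap_sum comp_sumr comp_suml. Qed.
End Hcomp.

Lemma hcompA (i j k l m n : int) (eij : i + j = l) (elk : l + k = n)
    (ejk : j + k = m) (eim : i + m = n) X Y Z W
    (h : mor Z (pw P k W)) (g : mor Y (pw P j Z)) (f : mor X (pw P i Y)) :
  hcomp elk h (hcomp eij g f) = hcomp eim (hcomp ejk h g) f.
Proof.
rewrite /hcomp !fmapM !compA; congr (_ \oc _ \oc _).
rewrite -(pw_muA P eij elk ejk eim) -!compA; congr (_ \oc _).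
exact/esym/(pw_mu_nat P eij).
Qed.

Fact int_split (i k : int) : i + (k - i) = k.
Proof. by rewrite addrC subrK. Qed.

(* (g o f)_k = \sum_(i + j = k) g_j o f_i *)
Definition orbit_comp_fun X Y Z (g : orbit_hom Y Z) (f : orbit_hom X Y) (k : int) :
    mor X (pw P k Z) :=
  \sum_(i \in [set: int]%classic) hcomp (int_split i k) (g (k - i)) (f i).

Lemma orbit_comp_seq X Y Z (g : orbit_hom Y Z) (f : orbit_hom X Y) k (s : seq int) :
  uniq s -> (forall i, i \notin s -> f i = 0) ->
  orbit_comp_fun g f k = \sum_(i <- s) hcomp (int_split i k) (g (k - i)) (f i).
Proof.
move=> us sP; rewrite /orbit_comp_fun (fsbigE s) //.
  by apply: eq_bigl => i; rewrite in_setT.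
by move=> i _ /sP ->; rewrite hcompm0.
Qed.

Fact orbit_comp_supp X Y Z (g : orbit_hom Y Z) (f : orbit_hom X Y) :
  exists s : seq int, forall k, k \notin s -> orbit_comp_fun g f k = 0.
Proof.
have [s [us sP]] := orbit_supp f; have [t [_ tP]] := orbit_supp g.
exists [seq i + j | i <- s, j <- t] => k ks.
rewrite (orbit_comp_seq g k us sP) big1_seq // => i /= si.
rewrite tP ?hcomp0m //; apply: contra ks => ti.
by apply/allpairsP; exists (i, k - i); rewrite /= int_split.
Qed.
Definition orbit_comp X Y Z (g : orbit_hom Y Z) (f : orbit_hom X Y) : orbit_hom X Z :=
  orbit_mk (orbit_comp_supp g f).

Definition orbit_id_fun X (i : int) : mor X (pw P i X) :=
  match i return mor X (pw P i X) with Posz 0 => pw_eps P X | _ => 0 end.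
Fact orbit_id_supp X :
  exists s : seq int, forall i, i \notin s -> orbit_id_fun X i = 0.
Proof. by exists [:: 0] => -[[|i]|i]. Qed.
Definition orbit_id X : orbit_hom X X := orbit_mk (orbit_id_supp X).

Fact orbit_comp_linearl X Y Z (f : orbit_hom X Y) :
  linear (fun g : orbit_hom Y Z => orbit_comp g f).
Proof.
have [s [us sP]] := orbit_supp f => a u v; apply: orbit_eq => k.
rewrite [RHS](_ : _ = a *: orbit_comp_fun u f k + orbit_comp_fun v f k) //.
rewrite [LHS](_ : _ = orbit_comp_fun (a *: u + v) f k) //.
rewrite !(orbit_comp_seq _ k us sP) scaler_sumr -big_split.
by apply: eq_bigr => i _; apply: hcomp_linearl.
Qed.
Fact orbit_comp_linearr X Y Z (g : orbit_hom Y Z) :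
  linear (fun f : orbit_hom X Y => orbit_comp g f).
Proof.
move=> a u v; apply: orbit_eq => k.
have [s [us sP]] := orbit_supp u; have [t [_ tP]] := orbit_supp v.
have uw : uniq (undup (s ++ t)) by apply: undup_uniq.
have uP i : i \notin undup (s ++ t) -> u i = 0.
  by rewrite mem_undup mem_cat negb_or => /andP[/sP].
have vP i : i \notin undup (s ++ t) -> v i = 0.
  by rewrite mem_undup mem_cat negb_or => /andP[_ /tP].
have uvP i : i \notin undup (s ++ t) -> (a *: u + v) i = 0.
  move=> /[dup] /uP ui /vP vi.
  by rewrite [LHS](_ : _ = a *: u i + v i) // ui vi scaler0 addr0.
rewrite [RHS](_ : _ = a *: orbit_comp_fun g u k + orbit_comp_fun g v k) //.
rewrite [LHS](_ : _ = orbit_comp_fun g (a *: u + v) k) //.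
rewrite (orbit_comp_seq g k uw uP) (orbit_comp_seq g k uw vP).
rewrite (orbit_comp_seq g k uw uvP) scaler_sumr -big_split.
by apply: eq_bigr => i _; apply: hcomp_linearr.
Qed.

Lemma hcomp_eq (i j j' k : int) (e : i + j = k) (e' : i + j' = k) X Y Z
    (g : forall j, mor Y (pw P j Z)) (f : mor X (pw P i Y)) :
  hcomp e (g j) f = hcomp e' (g j') f.
Proof.
have jj : j = j' by apply: (addrI i); rewrite e e'.
by case: _ / jj in e' *; rewrite (eq_irrelevance e e').
Qed.

Fact orbit_compA X Y Z W (h : orbit_hom Z W) (g : orbit_hom Y Z) (f : orbit_hom X Y) :
  orbit_comp h (orbit_comp g f) = orbit_comp (orbit_comp h g) f.
Proof.
apply: orbit_eq => n.
have [s [us sP]] := orbit_supp f; have [t [ut tP]] := orbit_supp g.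
pose r := undup [seq i + j | i <- s, j <- t].
have ur : uniq r by apply: undup_uniq.
have rP l : l \notin r -> orbit_comp g f l = 0.
  rewrite mem_undup => lr; rewrite [LHS](orbit_comp_seq g l us sP).
  rewrite big1_seq // => i /= si; rewrite tP ?hcomp0m //; apply: contra lr => ti.
  by apply/allpairsP; exists (i, l - i); rewrite /= int_split.
rewrite [LHS](orbit_comp_seq h n ur rP) [RHS](orbit_comp_seq _ n us sP).
transitivity (\sum_(l <- r) \sum_(i <- s)
    hcomp (int_split l n) (h (n - l)) (hcomp (int_split i l) (g (l - i)) (f i))).
  apply: eq_bigr => l _; rewrite -hcomp_sumr; congr hcomp.
  exact: orbit_comp_seq.
rewrite exchange_big /=; apply: eq_big_seq => i si.
transitivity (hcomp (int_split i n)
    (\sum_(j <- t) hcomp (int_split j (n - i)) (h (n - i - j)) (g j)) (f i)); last first.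
  by congr hcomp; apply/esym/orbit_comp_seq.
rewrite hcomp_suml.
pose G l := hcomp (int_split l n) (h (n - l)) (hcomp (int_split i l) (g (l - i)) (f i)).
have G0 l : l \notin [seq i + j | j <- t] -> G l = 0.
  move=> lt; rewrite /G tP ?hcomp0m ?hcompm0 //; apply: contra lt => lt.
  by apply/mapP; exists (l - i); rewrite ?int_split.
transitivity (\sum_(l <- [seq i + j | j <- t]) G l).
  rewrite (bigID (mem [seq i + j | j <- t])) /= [X in _ + X]big1 ?addr0; last first.
    by move=> l /G0.
  rewrite -big_filter; apply: perm_big; apply: uniq_perm.
  - exact: filter_uniq.
  - by rewrite map_inj_uniq //; apply: addrI.
  move=> l; rewrite mem_filter andb_idr // => /mapP[j tj ->].
  by rewrite mem_undup; apply/allpairsP; exists (i, j).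
rewrite big_map; apply: eq_big_seq => j _; rewrite /G.
have ek : j + (n - (i + j)) = n - i by lia.
rewrite (hcomp_eq (int_split i (i + j)) (erefl (i + j)) g (f i)).
rewrite (hcompA _ _ ek (int_split i n)); congr hcomp.
exact: (hcomp_eq _ _ h).
Qed.

Fact orbit_comp1m X Y (f : orbit_hom X Y) : orbit_comp (orbit_id Y) f = f.
Proof.
apply: orbit_eq => k; have [s [us sP]] := orbit_supp f.
rewrite [LHS](orbit_comp_seq _ k us sP).
have idE i : i != k -> hcomp (int_split i k) (orbit_id Y (k - i)) (f i) = 0.
  move=> ik; rewrite (_ : orbit_id Y (k - i) = 0) ?hcomp0m //.
  have : k - i != 0 by rewrite subr_eq0 eq_sym.
  by rewrite /dsum_fun /=; case: (k - i) => [[|m]|m].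
have idk : hcomp (int_split k k) (orbit_id Y (k - k)) (f k) = f k.
  rewrite (hcomp_eq (int_split k k) (addr0 k) (orbit_id Y) (f k)).
  by rewrite /hcomp /dsum_fun /= pw_mur1 comp1m.
have [ks|ks] := boolP (k \in s).
  by rewrite (bigD1_seq k) //= idk big1 ?addr0 // => i /idE.
rewrite sP // big1_seq // => i /= si; apply: idE.
by apply: contraNneq ks => <-.
Qed.

Fact orbit_compm1 X Y (f : orbit_hom X Y) : orbit_comp f (orbit_id X) = f.
Proof.
apply: orbit_eq => k.
have idP i : i \notin [:: 0] -> orbit_id X i = 0 by case: i => [[|i]|i].
rewrite [LHS](orbit_comp_seq f k (erefl : uniq [:: 0]) idP) big_seq1.
rewrite (hcomp_eq _ (add0r k) f) /hcomp /dsum_fun /=.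
by rewrite -compA -[fmap _ _ \oc _](pw_eps_nat P (f k)) compA pw_mul1 comp1m.
Qed.

(* Hom(X, Y) = \bigoplus_i Hom(X, F^i Y); an orbit is represented by any of its
   members. *)
Definition orbit_cat : lincat K :=
  @LinCat K C orbit_hom orbit_id orbit_comp orbit_comp_linearl orbit_comp_linearr
    orbit_compA orbit_comp1m orbit_compm1.
End Orbit.

Definition cluster_cat (K : fieldType) (H : abcat K) (D : derived_cat H)
    (tau : ar_translation D) (P : int_powers (cluster_functor tau)) : lincat K :=
  orbit_cat P.

(* Unital associative algebras, possibly zero, as endomorphism algebras may be;
   the algType of MathComp are nonzero. *)
Record alg (R : pzRingType) := Alg {
  alg_mod :> lmodType R;
  amul : alg_mod -> alg_mod -> alg_mod;
  aone : alg_mod;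
  amulA : associative amul;
  amul1m : left_id aone amul;
  amulm1 : right_id aone amul;
  amul_linearl : forall y, linear (fun x => amul x y);
  amul_linearr : forall x, linear (amul x) }.
Arguments amul {R a} x y : rename.
Arguments aone {R a}.

Definition alg_iso (R : pzRingType) (A B : alg R) : Prop :=
  exists f : A -> B, [/\ linear f, bijective f, f aone = aone
    & forall x y, f (amul x y) = amul (f x) (f y)].

(* The product f g is f \oc g. *)
Definition end_alg (K : fieldType) (C : lincat K) (X : C) : alg K :=
  @Alg K (mor X X) cmp (idm X) (@compA K C X X X X) (@comp1m K C X X)
    (@compm1 K C X X) (@comp_linearl K C X X X) (@comp_linearr K C X X X).

(* A-bimodule structures on the vector space M, with K acting centrally *)
Record bimod (R : pzRingType) (A : alg R) (M : lmodType R) := Bimod {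
  lact : A -> M -> M;
  ract : M -> A -> M;
  lact_linearl : forall m, linear (fun a => lact a m);
  lact_linearr : forall a, linear (lact a);
  ract_linearl : forall a, linear (fun m => ract m a);
  ract_linearr : forall m, linear (ract m);
  lact1 : forall m, lact aone m = m;
  ract1 : forall m, ract m aone = m;
  lactM : forall a b m, lact (amul a b) m = lact a (lact b m);
  ractM : forall a b m, ract m (amul a b) = ract (ract m a) b;
  lractA : forall a m b, ract (lact a m) b = lact a (ract m b) }.

Section Dual_bimod.
Variables (R : comPzRingType) (A : alg R) (M : lmodType R) (B : bimod A M).
Implicit Types (a b : A) (p q : dual M).

Fact dual_lact_scalar a p : scalar (fun m => p (ract B m a)).
Proof. by move=> c u v; rewrite ract_linearl dual_scalar. Qed.
Fact dual_ract_scalar p a : scalar (fun m => p (lact B a m)).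
Proof. by move=> c u v; rewrite lact_linearr dual_scalar. Qed.
(* (a p)(m) = p(m a) and (p a)(m) = p(a m) *)
Definition dual_lact a p : dual M := dual_mk (dual_lact_scalar a p).
Definition dual_ract p a : dual M := dual_mk (dual_ract_scalar p a).

Fact dual_lact_linearl p : linear (fun a => dual_lact a p).
Proof.
move=> c a b; apply: dual_eq => m; rewrite dualDE dualZE.
transitivity (p (c *: ract B m a + ract B m b)); last exact: dual_scalar.
by congr (p _); apply: ract_linearr.
Qed.
Fact dual_lact_linearr a : linear (dual_lact a).
Proof. by move=> c p q; apply: dual_eq => m; rewrite dualDE dualZE. Qed.
Fact dual_ract_linearl a : linear (fun p => dual_ract p a).
Proof. by move=> c p q; apply: dual_eq => m; rewrite dualDE dualZE. Qed.
Fact dual_ract_linearr p : linear (dual_ract p).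
Proof.
move=> c a b; apply: dual_eq => m; rewrite dualDE dualZE.
transitivity (p (c *: lact B a m + lact B b m)); last exact: dual_scalar.
by congr (p _); apply: lact_linearl.
Qed.
Fact dual_lact1 p : dual_lact aone p = p.
Proof. by apply: dual_eq => m; rewrite -[in RHS](ract1 B m). Qed.
Fact dual_ract1 p : dual_ract p aone = p.
Proof. by apply: dual_eq => m; rewrite -[in RHS](lact1 B m). Qed.
Fact dual_lactM a b p : dual_lact (amul a b) p = dual_lact a (dual_lact b p).
Proof. by apply: dual_eq => m; congr (p _); apply: ractM. Qed.
Fact dual_ractM a b p : dual_ract p (amul a b) = dual_ract (dual_ract p a) b.
Proof. by apply: dual_eq => m; congr (p _); apply: lactM. Qed.
Fact dual_lractA a p b : dual_ract (dual_lact a p) b = dual_lact a (dual_ract p b).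
Proof. by apply: dual_eq => m; congr (p _); apply: lractA. Qed.

Definition dual_bimod : bimod A (dual M) :=
  Bimod dual_lact_linearl dual_lact_linearr dual_ract_linearl dual_ract_linearr
    dual_lact1 dual_ract1 dual_lactM dual_ractM dual_lractA.
End Dual_bimod.

(* Hom(F T, G T) as a bimodule over End(T): a.h = G(a) o h and h.a = h o F(a). *)
Section Hom_bimod.
Variables (K : fieldType) (C D : lincat K) (F G : functor C D) (T : C).
Local Notation A := (end_alg T).
Local Notation M := (mor (F T) (G T)).
Definition hom_lact (a : A) (h : M) : M := fmap G (a : mor T T) \oc h.
Definition hom_ract (h : M) (a : A) : M := h \oc fmap F (a : mor T T).
Fact hom_lact_linearl h : linear (fun a => hom_lact a h).
Proof. by move=> c a b; rewrite /hom_lact fmap_linear comp_linearl. Qed.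
Fact hom_lact_linearr a : linear (hom_lact a).
Proof. exact: comp_linearr. Qed.
Fact hom_ract_linearl a : linear (fun h => hom_ract h a).
Proof. exact: comp_linearl. Qed.
Fact hom_ract_linearr h : linear (hom_ract h).
Proof. by move=> c a b; rewrite /hom_ract fmap_linear comp_linearr. Qed.
Fact hom_lact1 h : hom_lact aone h = h.
Proof. by rewrite /hom_lact fmap1 comp1m. Qed.
Fact hom_ract1 h : hom_ract h aone = h.
Proof. by rewrite /hom_ract fmap1 compm1. Qed.
Fact hom_lactM a b h : hom_lact (amul a b) h = hom_lact a (hom_lact b h).
Proof. by rewrite /hom_lact fmapM compA. Qed.
Fact hom_ractM a b h : hom_ract h (amul a b) = hom_ract (hom_ract h a) b.
Proof. by rewrite /hom_ract fmapM compA. Qed.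
Fact hom_lractA a h b : hom_ract (hom_lact a h) b = hom_lact a (hom_ract h b).
Proof. by rewrite /hom_ract /hom_lact compA. Qed.
Definition hom_bimod : bimod A M :=
  Bimod hom_lact_linearl hom_lact_linearr hom_ract_linearl hom_ract_linearr
    hom_lact1 hom_ract1 hom_lactM hom_ractM hom_lractA.
End Hom_bimod.

Definition bimod_iso (R : pzRingType) (A : alg R) (M N : lmodType R)
    (B : bimod A M) (B' : bimod A N) : Prop :=
  exists t : M -> N,
    [/\ linear t, bijective t, forall a m, t (lact B a m) = lact B' a (t m)
      & forall m a, t (ract B m a) = ract B' (t m) a].

Section Trivext.
Variables (R : pzRingType) (A : alg R) (M : lmodType R) (B : bimod A M).
Local Notation E := (A * M)%type.
Implicit Types x y z : E.

Definition trivext_mul x y : E :=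
  (amul x.1 y.1, lact B x.1 y.2 + ract B x.2 y.1).
Definition trivext_one : E := (aone, 0).

Lemma lactDr a m n : lact B a (m + n) = lact B a m + lact B a n.
Proof. by have := lact_linearr B a 1 m n; rewrite !scale1r. Qed.
Lemma ractDl a m n : ract B (m + n) a = ract B m a + ract B n a.
Proof. by have := ract_linearl B a 1 m n; rewrite !scale1r. Qed.
Lemma lact0 a : lact B a 0 = 0.
Proof. by apply: (addrI (lact B a 0)); rewrite -lactDr !addr0. Qed.
Lemma ract0 a : ract B 0 a = 0.
Proof. by apply: (addrI (ract B 0 a)); rewrite -ractDl !addr0. Qed.

Fact trivext_mulA : associative trivext_mul.
Proof.
move=> x y z; rewrite /trivext_mul /= amulA; congr pair.
by rewrite lactDr ractDl lactM ractM lractA addrA.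
Qed.
Fact trivext_mul1m : left_id trivext_one trivext_mul.
Proof. by case=> a m; rewrite /trivext_mul /= amul1m lact1 ract0 addr0. Qed.
Fact trivext_mulm1 : right_id trivext_one trivext_mul.
Proof. by case=> a m; rewrite /trivext_mul /= amulm1 ract1 lact0 add0r. Qed.
Fact trivext_mul_linearl y : linear (fun x => trivext_mul x y).
Proof.
move=> c x z; rewrite /trivext_mul /= amul_linearl; congr pair.
by rewrite lact_linearl ract_linearl addrACA -scalerDr.
Qed.
Fact trivext_mul_linearr x : linear (trivext_mul x).
Proof.
move=> c y z; rewrite /trivext_mul /= amul_linearr; congr pair.
by rewrite lact_linearr ract_linearr addrACA -scalerDr.
Qed.

Definition trivext : alg R :=
  @Alg R E trivext_mul trivext_one trivext_mulA trivext_mul1m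
    trivext_mulm1 trivext_mul_linearl trivext_mul_linearr.
End Trivext.

(* Main.v *)
From HB Require Import structures.
From mathcomp Require Import all_boot all_order all_algebra.
From mathcomp Require Import zify boolp classical_sets.
Require Import Defs.

(* Lambda is graded by the exponent of F, and the vanishing of Hom(T, F^i T) for
   i <> 0, 1 makes it A (+) Hom(T, F T) with product zero on the second summand.
   Serre duality and the commutation of tau with [1] give
     Hom(T, tau^-1 T[1]) ~ Hom(tau T, T[1]) ~ D Hom(T[1], tau (tau T)[1])
       ~ D Hom(T, tau^2 T),
   naturally in T, that is, as A-bimodules.
   The vanishing holds because tau preserves the class D^(>=0) of the objects Z
   with Hom(V[k], Z) = 0 for V in H and k > 0: by Serre duality this amounts to
   Hom(Z, V[m]) = 0 for m >= 2, which a brutal filtration of Z reduces to the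
   vanishing of Ext^(>=2).
   Finally, for X indecomposable in H, tau X is either in H, where it is tau_H X,
   or satisfies Hom(H, tau X) = 0, and then X is projective; by additivity
   Hom_H(T, tau_H^2 T) and Hom_D(T, tau^2 T) are isomorphic vector spaces. *)

Set Implicit Arguments.
Unset Strict Implicit.
Unset Printing Implicit Defensive.
Import GRing.Theory.
Local Open Scope ring_scope.

(** * Linear and abelian categories *)

Section Basics.
Variables (K : fieldType) (C : lincat K).
Implicit Types X Y Z : C.

(** The data of [derived_cat] contain no triangles, no cohomology functor on D and no inverse of the
    shift. Serre duality supplies what is missing about the shift: S = tau [1] is fully faithful,
    hence so is [1], tau being an equivalence. Triangles are replaced by explicit homotopies, on
    brutal truncations and on cones of maps from a stalk complex. Stability of D^(>=0) under tau
    settles only the negative powers of F. For i >= 2 Serre duality turns Hom(T, F^i T) into the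
    dual of Hom(T, F^-i S T), and F^-i S is F^(1-i) tau^2, again with a negative exponent; for i = 1
    it is tau^2 itself, whence the bimodule. As tau_H is given on objects only, the linear
    isomorphism between Hom_H(T, tau_H^2 T) and Hom_D(T, tau^2 T) carries no naturality, and the
    bimodule structure is transported along it. *)

Definition hom_zero X Y : Prop := forall f : mor X Y, f = 0.

Lemma zero_dom X Y (f : mor X Y) : is_zero X -> f = 0.
Proof. by move=> X0; rewrite -(compm1 f) X0 compm0. Qed.

Lemma zero_cod X Y (f : mor X Y) : is_zero Y -> f = 0.
Proof. by move=> Y0; rewrite -(comp1m f) Y0 comp0m. Qed.

Lemma iso_refl X : iso X X.
Proof. by exists (idm X); exists (idm X); rewrite comp1m. Qed.

Lemma iso_sym X Y : iso X Y -> iso Y X.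
Proof. by case=> f [g [gf fg]]; exists g; exists f. Qed.

Lemma is_iso_comp X Y Z (g : mor Y Z) (f : mor X Y) :
  is_iso g -> is_iso f -> is_iso (g \oc f).
Proof.
move=> [g' [g'g gg']] [f' [f'f ff']]; exists (f' \oc g'); split.
  by rewrite compA -(compA f') g'g compm1.
by rewrite compA -(compA g) ff' compm1.
Qed.

Lemma iso_trans X Y Z : iso X Y -> iso Y Z -> iso X Z.
Proof. by move=> [f fi] [g gi]; exists (g \oc f); apply: is_iso_comp. Qed.

Lemma is_iso_mono X Y (f : mor X Y) : is_iso f -> is_mono f.
Proof.
by move=> [g [gf _]] W u v /(congr1 (cmp g)); rewrite !compA gf !comp1m.
Qed.

Lemma is_iso_epi X Y (f : mor X Y) : is_iso f -> is_epi f.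
Proof.
move=> [g [_ fg]] W u v /(congr1 (fun h => h \oc g)).
by rewrite -!compA fg !compm1.
Qed.

Lemma hom_zero_iso X X' Y Y' :
  iso X X' -> iso Y Y' -> hom_zero X Y -> hom_zero X' Y'.
Proof.
move=> [a [b [_ ab]]] [c [d [_ cd]]] h f.
by rewrite -(comp1m f) -cd -(compm1 (c \oc d \oc f)) -ab !compA -(compA c)
  -(compA c) (h (d \oc f \oc a)) compm0 comp0m.
Qed.

Lemma zero_mono X Y (f : mor X Y) :
  (forall W (u : mor W X), f \oc u = 0 -> u = 0) -> is_mono f.
Proof.
move=> h W u v fuv; apply/eqP; rewrite -subr_eq0; apply/eqP/h.
by rewrite compDr compNr fuv subrr.
Qed.

Lemma zero_epi X Y (f : mor X Y) :
  (forall W (u : mor Y W), u \oc f = 0 -> u = 0) -> is_epi f.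
Proof.
move=> h W u v fuv; apply/eqP; rewrite -subr_eq0; apply/eqP/h.
by rewrite compDl compNl fuv subrr.
Qed.

Lemma epi_zero X Y (f : mor X Y) W (u : mor Y W) :
  is_epi f -> u \oc f = 0 -> u = 0.
Proof. by move=> fe uf; apply: fe; rewrite uf comp0m. Qed.

Lemma mono_zero X Y (f : mor X Y) W (u : mor W X) :
  is_mono f -> f \oc u = 0 -> u = 0.
Proof. by move=> fm uf; apply: fm; rewrite uf compm0. Qed.

Lemma epi_comp X Y Z (g : mor Y Z) (f : mor X Y) :
  is_epi g -> is_epi f -> is_epi (g \oc f).
Proof. by move=> ge fe W u v; rewrite !compA => /fe /ge. Qed.

Lemma epi_id X : is_epi (idm X).
Proof. by move=> W u v; rewrite !compm1. Qed.

Lemma kernel_mono X Y W (f : mor X Y) (k : mor W X) : is_kernel f k -> is_mono k.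
Proof.
move=> [fk kP] V u v kuv.
have [|w [_ wU]] := kP V (k \oc v); first by rewrite compA fk comp0m.
by rewrite -(wU u) // -(wU v).
Qed.

Lemma cokernel_epi X Y W (f : mor X Y) (q : mor Y W) : is_cokernel f q -> is_epi q.
Proof.
move=> [qf qP] V u v quv.
have [|w [_ wU]] := qP V (v \oc q); first by rewrite -compA qf compm0.
by rewrite -(wU u) // -(wU v).
Qed.

Lemma kernel_lift X Y W (f : mor X Y) (k : mor W X) V (u : mor V X) :
  is_kernel f k -> f \oc u = 0 -> exists v, k \oc v = u.
Proof. by move=> [_ kP] /kP[v [vP _]]; exists v. Qed.

Lemma cokernel_desc X Y W (f : mor X Y) (q : mor Y W) V (u : mor Y V) :
  is_cokernel f q -> u \oc f = 0 -> exists v, v \oc q = u.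
Proof. by move=> [_ qP] /qP[v [vP _]]; exists v. Qed.

End Basics.

Section FunctorBasics.
Variables (K : fieldType) (C D : lincat K) (F : functor C D).

Definition faithful : Prop :=
  forall (X Y : C) (f : mor X Y), fmap F f = 0 -> f = 0.
Definition full : Prop :=
  forall (X Y : C) (g : mor (F X) (F Y)), exists f : mor X Y, fmap F f = g.

Lemma fmapN X Y (f : mor X Y) : fmap F (- f) = - fmap F f.
Proof. by rewrite -!scaleN1r fmapZ. Qed.

Lemma faithful_inj X Y (f g : mor X Y) : faithful -> fmap F f = fmap F g -> f = g.
Proof.
move=> Ff fg; apply/eqP; rewrite -subr_eq0; apply/eqP/Ff.
by rewrite fmapD fmapN fg subrr.
Qed.

Lemma fmap_is_iso X Y (f : mor X Y) : is_iso f -> is_iso (fmap F f).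
Proof.
by move=> [g [gf fg]]; exists (fmap F g); rewrite -!fmapM gf fg !fmap1.
Qed.

Lemma fmap_iso X Y : iso X Y -> iso (F X) (F Y).
Proof. by move=> [f fi]; exists (fmap F f); apply: fmap_is_iso. Qed.

Lemma fmap_is_sum X Y Z : is_sum X Y Z -> is_sum (F X) (F Y) (F Z).
Proof.
move=> [i [j [p [q [pi qj pj qi ij]]]]].
exists (fmap F i), (fmap F j), (fmap F p), (fmap F q).
by rewrite -!fmapM -fmapD pi qj pj qi ij !fmap1 !fmap0.
Qed.

Lemma ff_is_iso X Y (f : mor X Y) :
  full -> faithful -> is_iso (fmap F f) -> is_iso f.
Proof.
move=> Fu Fa [g [gf fg]]; have [h hg] := Fu _ _ g; exists h; split;
  by apply: (faithful_inj Fa); rewrite fmapM fmap1 hg.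
Qed.

Lemma fmap_hom_zero X Y : faithful -> hom_zero (F X) (F Y) -> hom_zero X Y.
Proof. by move=> Fa h f; apply: Fa; apply: h. Qed.

Lemma full_hom_zero X Y : full -> hom_zero X Y -> hom_zero (F X) (F Y).
Proof. by move=> Fu h f; have [g <-] := Fu _ _ f; rewrite (h g) fmap0. Qed.

End FunctorBasics.

Lemma fiso_iso (K : fieldType) (C D : lincat K) (F G : functor C D) X :
  fiso F G -> iso (F X) (G X).
Proof. by move=> [a [_ ai]]; exists (a X). Qed.

Section Autoequiv.
Variables (K : fieldType) (C : lincat K) (F : autoequiv C).

Lemma ae_faithful : faithful F.
Proof.
move=> X Y f Ff0; have [a [an ai]] := ae_unit F.
apply: (mono_zero (is_iso_mono (ai Y))).
by have := an X Y f; rewrite /= Ff0 fmap0 comp0m.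
Qed.

Lemma ae_inv_faithful : faithful (ae_inv F).
Proof.
move=> X Y f Ff0; have [a [an ai]] := ae_counit F.
apply: (epi_zero (is_iso_epi (ai X))).
by have := an X Y f; rewrite /= Ff0 fmap0 compm0.
Qed.

Lemma ae_full : full F.
Proof.
move=> X Y g; have [a [an ai]] := ae_unit F.
have [b [ba ab]] := ai Y.
exists (b \oc fmap (ae_inv F) g \oc a X).
apply: (faithful_inj ae_inv_faithful); apply: (is_iso_epi (ai X)).
have /= <- := an X Y (b \oc fmap (ae_inv F) g \oc a X).
by rewrite !compA ab comp1m.
Qed.

End Autoequiv.

(** * Diagram chases in an abelian category *)

Section Abelian.
Variables (K : fieldType) (H : abcat K).
Implicit Types X Y Z V : H.

Lemma epi_cokernel X Y W (e : mor X Y) (k : mor W X) :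
  is_epi e -> is_kernel e k -> is_cokernel k e.
Proof.
move=> ee ke; have [W' [g [eg gP]]] := ab_epi ee; split; first by case: ke.
move=> V u uk; have [g' g'P] := kernel_lift ke eg.
by apply: gP; rewrite -g'P compA uk comp0m.
Qed.

(* Diagram chases below use morphisms V -> X as elements of X; passing to an
   epimorphic cover of V replaces the choice of preimages. *)
Lemma epi_pullback X Y V (p : mor X Y) (f : mor V Y) :
  is_epi p ->
  exists V' (e : mor V' V) (f' : mor V' X), is_epi e /\ p \oc f' = f \oc e.
Proof.
move=> pe; have [Z [i [j [pr [qr [pi qj pj qi ij]]]]]] := ab_sum X V.
pose m := p \oc pr - f \oc qr.
have mi : m \oc i = p by rewrite /m compDl compNl -!compA pi qi compm0 subr0 compm1.
have me : is_epi m.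
  apply: zero_epi => W u um; apply: (epi_zero pe).
  by rewrite -mi compA um comp0m.
have [W [k kP]] := ab_ker m; exists W, (qr \oc k), (pr \oc k); split; last first.
  apply/eqP; rewrite -subr_eq0; apply/eqP; case: kP => mk _.
  by rewrite !compA -compNl -compDl.
(* The epimorphism [m] is the cokernel of [k], so [u \oc qr] is some [v \oc m]; restricted to X this
   reads v p = 0, so v = 0. *)
apply: zero_epi => U u; rewrite compA => uk.
have [v vm] := cokernel_desc (epi_cokernel me kP) uk.
have v0 : v = 0 by apply: (epi_zero pe); rewrite -mi compA vm -compA qi compm0.
by rewrite -(compm1 u) -qj compA -vm v0 !comp0m.
Qed.

(** If [u] kills [d'], then [d] factors through the subobject [k \oc k'], k' = ker u. This subobject
    is the kernel of some [g]; as g kills d it factors through the cokernel [q], so it kills [k].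
    Thus k' has a section and u = 0. *)
Lemma image_epi X Y Z W (d : mor X Y) (q : mor Y Z) (k : mor W Y) (d' : mor X W) :
  is_cokernel d q -> is_kernel q k -> k \oc d' = d -> is_epi d'.
Proof.
move=> dq qk kd; apply: zero_epi => U u ud.
have [I' [k' k'P]] := ab_ker u; have [d'' d''P] := kernel_lift k'P ud.
have km : is_mono (k \oc k').
  move=> V a b; rewrite -!compA => /(kernel_mono qk); exact: (kernel_mono k'P).
have [G [g gP]] := ab_mono km.
have gd : g \oc d = 0.
  by case: gP => gkk _; rewrite -kd -d''P [k \oc _]compA compA gkk comp0m.
have [g' g'q] := cokernel_desc dq gd.
have gk : g \oc k = 0 by case: qk => qk _; rewrite -g'q -compA qk compm0.
have [t] := kernel_lift gP gk; rewrite -compA -[in RHS](compm1 k).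
move=> /(kernel_mono qk) kt; rewrite -(compm1 u) -kt compA.
by case: k'P => -> _; rewrite comp0m.
Qed.

Lemma exact_lift X Y Z V (d : mor X Y) (q : mor Y Z) (f : mor V Y) :
  is_cokernel d q -> q \oc f = 0 ->
  exists V' (e : mor V' V) (w : mor V' X), is_epi e /\ d \oc w = f \oc e.
Proof.
move=> dq qf; have [W [k kP]] := ab_ker q.
have [d' d'P] := kernel_lift kP (proj1 dq).
have [f' f'P] := kernel_lift kP qf.
have [V' [e [w [ee wP]]]] := epi_pullback f' (image_epi dq kP d'P).
by exists V', e, w; rewrite -d'P -compA wP compA f'P.
Qed.

Lemma mono_epi_iso X Y (f : mor X Y) : is_mono f -> is_epi f -> is_iso f.
Proof.
move=> fm fe; have [W [g gP]] := ab_epi fe.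
have g0 : g = 0 by apply: (mono_zero fm); case: gP.
have [|v vf] := cokernel_desc (u := idm X) gP; first by rewrite g0 compm0.
exists v; split=> //; apply: fe; by rewrite -compA vf comp1m compm1.
Qed.

(** Preimages under a monomorphism are unique, so one found on a cover [e] descends: it kills the
    kernel of [e]. *)
Lemma mono_descend X Y V V' (s : mor X Y) (f : mor V Y) (e : mor V' V) (x : mor V' X) :
  is_mono s -> is_epi e -> s \oc x = f \oc e -> exists u, s \oc u = f.
Proof.
move=> sm ee sx; have [W [k kP]] := ab_ker e.
have xk : x \oc k = 0.
  by apply: (mono_zero sm); rewrite compA sx -compA (proj1 kP) compm0.
have [u ux] := cokernel_desc (epi_cokernel ee kP) xk.
by exists u; apply: ee; rewrite -compA ux.
Qed.

Lemma idem_split X (e : mor X X) : e \oc e = e ->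
  exists Y Z (i : mor Y X) (j : mor Z X) (p : mor X Y) (q : mor X Z),
    [/\ p \oc i = idm Y, q \oc j = idm Z, p \oc j = 0, q \oc i = 0
      & i \oc p + j \oc q = idm X] /\ i \oc p = e.
Proof.
move=> ee; have [Y [i iP]] := ab_ker (idm X - e); have [Z [j jP]] := ab_ker e.
have [|p pP] := kernel_lift (u := e) iP.
  by rewrite compDl compNl comp1m ee subrr.
have [|q qP] := kernel_lift (u := idm X - e) jP.
  by rewrite compDr compNr compm1 ee subrr.
have im := kernel_mono iP; have jm := kernel_mono jP.
have ei : e \oc i = i.
  case: iP => /eqP; rewrite compDl compNl comp1m subr_eq0 => /eqP <- //.
have ej : e \oc j = 0 by case: jP.
exists Y, Z, i, j, p, q; split=> //; split.
- by apply: im; rewrite compA pP ei compm1.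
- by apply: jm; rewrite compA qP compDl compNl comp1m ej subr0 compm1.
- by apply: im; rewrite compA pP ej compm0.
- by apply: jm; rewrite compA qP compDl compNl comp1m ei subrr compm0.
by rewrite pP qP addrC subrK.
Qed.

Lemma cohomology_ex (X : cplx H) i : exists hX : cohomology X i, True.
Proof.
have [Z [k kP]] := ab_ker (cd X (i + 1)).
have [b bP] := kernel_lift kP (cdd X i).
have [Q [q qP]] := ab_coker b.
by exists (Cohomology kP bP qP).
Qed.

(** Exactness in degree i + 1, not i: the index is that of the incoming differential, as in
    [cohomology]. *)
Definition acyclic_at (X : cplx H) (i : int) : Prop :=
  forall V (x : mor V (X (i + 1))), cd X (i + 1) \oc x = 0 ->
  exists V' (e : mor V' V) (w : mor V' (X i)), is_epi e /\ cd X i \oc w = x \oc e.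

Definition coh_inj (X Y : cplx H) (f : chain X Y) : Prop :=
  forall i V (x : mor V (X (i + 1))) (y : mor V (Y i)),
    cd X (i + 1) \oc x = 0 -> f (i + 1) \oc x = cd Y i \oc y ->
    exists V' (e : mor V' V) (w : mor V' (X i)),
      is_epi e /\ cd X i \oc w = x \oc e.

Definition coh_surj (X Y : cplx H) (f : chain X Y) : Prop :=
  forall i V (y : mor V (Y (i + 1))), cd Y (i + 1) \oc y = 0 ->
    exists V' (e : mor V' V) (x : mor V' (X (i + 1))) (w : mor V' (Y i)),
      [/\ is_epi e, cd X (i + 1) \oc x = 0
        & f (i + 1) \oc x + cd Y i \oc w = y \oc e].

(** [quasi_iso] quantifies over all presentations of the cohomology. Restating it on generalized
    elements, as injectivity and surjectivity in each degree, removes these choices; the direct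
    implication has to construct one presentation ([coh_map]). *)
Lemma quasi_isoP (X Y : cplx H) (f : chain X Y) :
  quasi_iso f <-> coh_inj f /\ coh_surj f.
Proof.
split=> [fq|[fi fs] i hX hY z c zP cP].
  have coh_map i : exists (hX : cohomology X i) (hY : cohomology Y i)
      (z : mor (cyc hX) (cyc hY)) (c : mor (coh hX) (coh hY)),
      [/\ cyc_in hY \oc z = f (i + 1) \oc cyc_in hX,
          c \oc coh_pr hX = coh_pr hY \oc z & is_iso c].
    have [hX _] := cohomology_ex X i; have [hY _] := cohomology_ex Y i.
    have [|z zP] := kernel_lift (u := f (i + 1) \oc cyc_in hX) (cyc_inP hY).
      by rewrite compA chain_comm -compA (proj1 (cyc_inP hX)) compm0.
    have [|c cP] := cokernel_desc (u := coh_pr hY \oc z) (coh_prP hX).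
      rewrite -compA (_ : z \oc _ = cyc_bd hY \oc f i).
        by rewrite compA (proj1 (coh_prP hY)) comp0m.
      apply: (kernel_mono (cyc_inP hY)).
      by rewrite compA zP -compA cyc_bdP compA cyc_bdP chain_comm.
    by exists hX, hY, z, c; split=> //; apply: fq cP.
  split=> i V.
    move=> x y dx fx; have [hX [hY [z [c [zP cP ci]]]]] := coh_map i.
    have [x' x'P] := kernel_lift (cyc_inP hX) dx.
    have x'0 : coh_pr hX \oc x' = 0.
      apply: (mono_zero (is_iso_mono ci)); rewrite compA cP -compA.
      rewrite (_ : z \oc x' = cyc_bd hY \oc y).
        by rewrite compA (proj1 (coh_prP hY)) comp0m.
      apply: (kernel_mono (cyc_inP hY)).
      by rewrite !compA zP -compA x'P fx cyc_bdP.
    have [V' [e [w [ee wP]]]] := exact_lift (coh_prP hX) x'0.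
    by exists V', e, w; split=> //; rewrite -(cyc_bdP hX) -compA wP compA x'P.
  move=> y dy; have [hX [hY [z [c [zP cP [c' [c'c cc']]]]]]] := coh_map i.
  have [y' y'P] := kernel_lift (cyc_inP hY) dy.
  (* [x] represents the inverse image under [c] of the class of y, so y - z x has class zero and is
     a boundary after a further cover. *)
  have [V1 [e1 [x [e1e xP]]]] :=
    epi_pullback (c' \oc coh_pr hY \oc y') (cokernel_epi (coh_prP hX)).
  have zx0 : coh_pr hY \oc (y' \oc e1 - z \oc x) = 0.
    by rewrite compDr compNr !compA -cP -(compA c) xP !compA cc' comp1m subrr.
  have [V2 [e2 [w [e2e wP]]]] := exact_lift (coh_prP hY) zx0.
  exists V2, (e1 \oc e2), (cyc_in hX \oc x \oc e2), w; split.
  - exact: epi_comp.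
  - by rewrite !compA (proj1 (cyc_inP hX)) !comp0m.
  rewrite -(cyc_bdP hY) -(compA (cyc_in hY)) wP !compA -zP -y'P.
  by rewrite compDr compNr compDl compNl !compA [LHS]addrC subrK.
apply: mono_epi_iso.
  apply: zero_mono => V u cu.
  have [V1 [e1 [x [e1e xP]]]] := epi_pullback u (cokernel_epi (coh_prP hX)).
  have : coh_pr hY \oc (z \oc x) = 0.
    by rewrite compA -cP -compA xP compA cu comp0m.
  move=> /(exact_lift (coh_prP hY))[V2 [e2 [y [e2e yP]]]].
  have [] := fi i V2 (cyc_in hX \oc x \oc e2) y.
  - by rewrite !compA (proj1 (cyc_inP hX)) !comp0m.
  - by rewrite !compA -zP -!compA (compA z) -yP compA cyc_bdP.
  move=> V3 [e3 [w [e3e wP]]].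
  have bw : cyc_bd hX \oc w = x \oc e2 \oc e3.
    by apply: (kernel_mono (cyc_inP hX)); rewrite compA cyc_bdP wP !compA.
  apply: (epi_zero (epi_comp (epi_comp e1e e2e) e3e)).
  by rewrite !compA -xP -!compA (compA x) -bw compA (proj1 (coh_prP hX)) comp0m.
apply: zero_epi => W u uc.
have [|V1 [e1 [x [w [e1e dx xP]]]]] := fs i _ (cyc_in hY).
  by rewrite (proj1 (cyc_inP hY)).
have [x' x'P] := kernel_lift (cyc_inP hX) dx.
have : u \oc coh_pr hY = 0; last exact/epi_zero/cokernel_epi/coh_prP.
apply: (epi_zero e1e).
have -> : u \oc coh_pr hY \oc e1 = u \oc coh_pr hY \oc (z \oc x' + cyc_bd hY \oc w).
  congr (_ \oc _); apply: (kernel_mono (cyc_inP hY)).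
  by rewrite -xP compDr !compA zP cyc_bdP -compA x'P.
rewrite compDr -compA (compA _ z) -cP !compA uc !comp0m add0r.
by rewrite -(compA u) (proj1 (coh_prP hY)) compm0 comp0m.
Qed.

End Abelian.

(** * Serre duality *)

(** A maximal subspace avoiding [v] exists by Zorn; maximality forces it to be complementary to the
    line of [v]. *)
Lemma line_complement (K : fieldType) (V : lmodType K) (v : V) : v != 0 ->
  exists A : set V,
    [/\ A 0, forall a u w, A u -> A w -> A (a *: u + w),
        ~ A v & forall w, exists a, A (w - a *: v)].
Proof.
move=> v0.
(* 0 is left out of [P] because the union of the empty chain is empty; maximality puts it back. *)
pose P (A : set V) := (forall a u w, A u -> A w -> A (a *: u + w)) /\ ~ A v.
have [F FP Ftot|A [[Alin Av] Amax]] := @Zorn_bigcup _ P.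
  split=> [a u w [X FX Xu] [Y FY Yw]|[X FX]]; last by case: (FP _ FX).
  have [XY|YX] := Ftot _ _ FX FY.
    by exists Y => //; apply: (FP _ FY).1 => //; apply: XY.
  by exists X => //; apply: (FP _ FX).1 => //; apply: YX.
have A0 : A 0.
  apply: contrapT => nA0; apply: (Amax [set x | A x \/ x = 0]%classic).
    split=> [|sub]; first by move=> x Ax; left.
    by apply: nA0; apply: sub; right.
  split=> [a u w|[//|v0']]; last by rewrite v0' eqxx in v0.
  move=> [Au [Aw|->]|-> [Aw|->]].
  - by left; apply: Alin.
  - by case: nA0; rewrite -(subrr u) addrC -scaleN1r; apply: Alin.
  - by left; rewrite scaler0 add0r.
  by right; rewrite scaler0 addr0.
exists A; split=> // w; have [Aw|nAw] := pselect (A w).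
  by exists 0; rewrite scale0r subr0.
pose B := [set x | exists c u, A u /\ x = c *: w + u]%classic.
have Bv : B v.
  apply: contrapT => nBv; apply: (Amax B).
    split=> [x Ax|sub]; first by exists 0, x; rewrite scale0r add0r.
    by apply: nAw; apply: sub; exists 1, 0; rewrite scale1r addr0.
  split=> // a u w' [c [x [Ax ->]]] [d [y [Ay ->]]].
  exists (a * c + d), (a *: x + y); split; first exact: Alin.
  by rewrite scalerDr scalerDl scalerA addrACA.
have [c [u [Au vE]]] := Bv; exists c^-1.
have c0 : c != 0.
  by apply/eqP => c0; apply: Av; rewrite vE c0 scale0r add0r.
rewrite vE scalerDr scalerA mulVf // scale1r opprD addrA subrr add0r -scaleNr.
by rewrite -(addr0 (_ *: _)); apply: Alin.
Qed.

(* The Hom spaces of D are not known to be finite-dimensional at this point, so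
   arbitrary vector spaces have to be considered. *)
Lemma dual_separates (K : fieldType) (V : lmodType K) (v : V) :
  (forall p : dual V, p v = 0) -> v = 0.
Proof.
move=> pv; apply/eqP; apply: contrapT => /negP v0.
have [A [A0 Alin Av Acov]] := line_complement v0.
have AB x y : A x -> A y -> A (x - y).
  by move=> Ax Ay; rewrite addrC -scaleN1r; apply: Alin.
have uniqA a b w : A (w - a *: v) -> A (w - b *: v) -> a = b.
  move=> wa wb; apply/eqP; rewrite -subr_eq0; apply: contrapT => /negP ab.
  apply: Av; rewrite -(scale1r v) -(mulVf ab) -scalerA -(addr0 (_ *: _)).
  apply: Alin => //; have := AB _ _ wb wa.
  by rewrite opprB addrC addrA subrK -scalerBl.
pose p w := sval (cid (Acov w)).
have pP w : A (w - p w *: v) := svalP (cid (Acov w)).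
have ps : scalar p.
  move=> a x y; apply: (uniqA _ _ (a *: x + y)); first exact: pP.
  have := Alin a _ _ (pP x) (pP y).
  by rewrite scalerBr scalerA addrACA -opprD -scalerDl.
have := pv (dual_mk ps); have : p v = 1.
  by apply: (uniqA _ _ v); [apply: pP | rewrite scale1r subrr].
rewrite /dual_fun /= => -> /eqP; by rewrite oner_eq0.
Qed.

Definition spanned (K : fieldType) (n : nat) (V : lmodType K) : Prop :=
  exists f : {linear 'rV[K]_n -> V}, forall v, exists x, f x = v.

(** If [x] is a coordinate vector of [v], a complement of its line, of dimension n - 1, still spans
    the quotient. *)
Lemma spanned_quotient (K : fieldType) (n : nat) (V W : lmodType K)
    (g : V -> W) (v : V) :
  linear g -> (forall w, exists u, g u = w) -> v != 0 -> g v = 0 ->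
  spanned n V -> exists2 m, (m < n)%N & spanned m W.
Proof.
move=> glin gs v0 gv [f fs]; have [x xv] := fs v.
pose gL := GRing.isLinear.Build _ _ _ _ g glin.
pose g' : {linear V -> W} := HB.pack g gL.
pose B := row_base (x^C)%MS.
exists (\rank (x^C)%MS).
  rewrite mxrank_compl; have : x != 0.
    by apply: contraNneq v0 => x0; rewrite -xv x0 linear0.
  by rewrite -mxrank_eq0; have := rank_leq_col x; lia.
exists (g' \o f \o mulmxr B)%FUN => w; have [u <-] := gs w; have [y <-] := fs u.
have : (y <= x + x^C)%MS by rewrite submx_full // addsmx_compl_full.
move=> /sub_addsmxP[[a b] /= ->].
have /submxP[z zP] : (b *m x^C <= B)%MS by rewrite eq_row_base submxMl.
exists z => /=; rewrite -zP linearD [RHS](linearD g') (_ : g' (f (a *m x)) = 0) ?add0r //.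
by rewrite [a]mx11_scalar mul_scalar_mx !linearZ /= xv gv scaler0.
Qed.

Lemma dualf0 (K : fieldType) (V : lmodType K) (f : dual V) : f 0 = 0.
Proof. by apply: (addrI (f 0)); rewrite -{1}[f 0]mul1r -dual_scalar scale1r !addr0. Qed.

Lemma dualBE (K : fieldType) (V : lmodType K) (f : dual V) u v :
  f (u - v) = f u - f v.
Proof. by rewrite addrC -scaleN1r dual_scalar mulN1r addrC. Qed.

Section Serre.
Variables (K : fieldType) (C : lincat K) (sh : functor C C) (tau : autoequiv C).
Local Notation S := (fcomp tau sh).
Hypothesis serreS : is_serre S.

Let phi X Y : mor X Y -> dual (mor Y (S X)) := sval (cid serreS) X Y.
Let phi_lin X Y : linear (@phi X Y).
Proof. by have [lb _ _] := svalP (cid serreS); case: (lb X Y). Qed.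
Let phi_bij X Y : bijective (@phi X Y).
Proof. by have [lb _ _] := svalP (cid serreS); case: (lb X Y). Qed.
Let phi_l X Y Z (g : mor Y Z) (f : mor X Y) (h : mor Z (S X)) :
  phi (g \oc f) h = phi f (h \oc g).
Proof. by have [_ l _] := svalP (cid serreS); apply: l. Qed.
Let phi_r W X Y (f : mor X Y) (e : mor W X) (h : mor Y (S W)) :
  phi (f \oc e) h = phi f (fmap S e \oc h).
Proof. by have [_ _ r] := svalP (cid serreS); apply: r. Qed.

Implicit Types X Y Z : C.

(** The duality evaluated at the identity. The whole pairing is (g, h) |-> tr (h g), and naturality
    in the first argument becomes the twisted cyclicity [trC]. *)
Definition serre_trace X (h : mor X (S X)) : K := phi (idm X) h.
Local Notation tr := serre_trace.

Lemma phiE X Y (g : mor X Y) (h : mor Y (S X)) : phi g h = tr (h \oc g).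
Proof. by rewrite -{1}(compm1 g) phi_l. Qed.

Lemma trC X Y (g : mor X Y) (h : mor Y (S X)) : tr (h \oc g) = tr (fmap S g \oc h).
Proof. by rewrite -phiE -{1}(comp1m g) phi_r. Qed.

Lemma phi_inj X Y (f : mor X Y) : (forall h, tr (h \oc f) = 0) -> f = 0.
Proof.
move=> h; have [g fg gf] := phi_bij X Y; apply: (can_inj fg); apply: dual_eq => k.
have phi0 : phi (0 : mor X Y) = 0.
  have := phi_lin 1 0 (0 : mor X Y); rewrite !scale1r addr0 => e.
  by apply: (addrI (phi (0 : mor X Y))); rewrite -e addr0.
by rewrite phi0 phiE h.
Qed.

Lemma phi_surj X Y (p : dual (mor Y (S X))) :
  exists f : mor X Y, forall h, tr (h \oc f) = p h.
Proof.
have [g fg gf] := phi_bij X Y; exists (g p) => h.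
by rewrite -phiE gf.
Qed.

Lemma tr0 X : tr (0 : mor X (S X)) = 0.
Proof. exact: dualf0. Qed.

Lemma trB X (u v : mor X (S X)) : tr (u - v) = tr u - tr v.
Proof. exact: dualBE. Qed.

Lemma serre_faithful : faithful S.
Proof.
by move=> X Y f Sf; apply: phi_inj => h; rewrite trC Sf comp0m tr0.
Qed.

(* The functional h |-> tr (g h) is represented by some f, and then S f and g
   agree under every functional. *)
Lemma serre_full : full S.
Proof.
move=> X Y g.
have ps : scalar (fun h : mor Y (S X) => tr (g \oc h)).
  by move=> a u v; rewrite compDr compZr /serre_trace dual_scalar.
have [f fP] := phi_surj (dual_mk ps); exists f.
apply/eqP; rewrite -subr_eq0; apply/eqP/dual_separates => p.
have [h hP] := phi_surj p.
by rewrite -hP compDl compNl trB -trC fP; apply: subrr.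
Qed.

Lemma sh_faithful : faithful sh.
Proof. by move=> X Y f f0; apply: serre_faithful; rewrite /= f0 fmap0. Qed.

Lemma sh_full : full sh.
Proof.
move=> X Y g; have [f fP] := serre_full (fmap tau g : mor (S X) (S Y)).
by exists f; apply: (faithful_inj (@ae_faithful _ _ tau)).
Qed.

Lemma serre_hom_zero X Y : hom_zero Y (S X) <-> hom_zero X Y.
Proof.
split=> h f; first by apply: phi_inj => k; rewrite (h k) comp0m tr0.
apply: phi_inj => g; have [g' <-] := serre_full g.
by rewrite -trC (h g') compm0 tr0.
Qed.

Lemma tr_inj X Y (h : mor Y (S X)) : (forall g : mor X Y, tr (h \oc g) = 0) -> h = 0.
Proof.
move=> hP; apply: phi_inj => k; have [g <-] := serre_full k.
by rewrite -trC.
Qed.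

(** Dualizing the Serre isomorphism would only reach a double dual. Instead [p] is moved along
    Hom(X, Y) ~ Hom(S X, S Y), and the duality for the pair (Y, S X) represents it. *)
Lemma tr_surj X Y (p : dual (mor X Y)) :
  exists h : mor Y (S X), forall g, tr (h \oc g) = p g.
Proof.
pose inv (k : mor (S X) (S Y)) := sval (cid (serre_full k)).
have invP k : fmap S (inv k) = k := svalP (cid (serre_full k)).
have ps : scalar (fun k => p (inv k)).
  move=> a u v; rewrite -dual_scalar; congr (p _).
  apply: (faithful_inj serre_faithful).
  by rewrite fmapD fmapZ !invP.
have [h hP] := phi_surj (dual_mk ps); exists h => g.
rewrite trC hP; congr (p _); exact/(faithful_inj serre_faithful)/invP.
Qed.

(* Both Hom(tau V, tau S X) and Hom(tau V, S tau X) represent the dual of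
   Hom(X, V); th is the comparison map. *)
Lemma serre_twist X : exists th : mor (tau (S X)) (S (tau X)),
  forall k : mor X (S X), tr (th \oc fmap tau k) = tr k.
Proof.
pose inv (k : mor (tau X) (tau (S X))) := sval (cid (ae_full k)).
have invP k : fmap tau (inv k) = k := svalP (cid (ae_full k)).
have tf := @ae_faithful _ _ tau.
have ps : scalar (fun k => tr (inv k)).
  move=> a u v; rewrite /serre_trace -dual_scalar; congr (phi _ _).
  by apply: (faithful_inj tf); rewrite fmapD fmapZ !invP.
have [h hP] := tr_surj (dual_mk ps); exists h => g.
by rewrite hP; congr (tr _); apply/(faithful_inj tf)/invP.
Qed.

(** A Yoneda argument on the objects tau V: composition with [th] is bijective on maps out of them.
    The counit presents S (tau X) as such an object, and its lift through [th] yields the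
    inverse. *)
Lemma serre_twist_iso X (th : mor (tau (S X)) (S (tau X))) :
  (forall k : mor X (S X), tr (th \oc fmap tau k) = tr k) -> is_iso th.
Proof.
move=> thP; have tfa := @ae_faithful _ _ tau; have tfu := @ae_full _ _ tau.
have [c [_ ci]] := ae_counit tau.
have inj V (u : mor (tau V) (tau (S X))) : th \oc u = 0 -> u = 0.
  have [v <-] := tfu _ _ u => thv; suff -> : v = 0 by rewrite fmap0.
  by apply: tr_inj => g; rewrite -thP fmapM compA thv comp0m tr0.
have surj V (w : mor (tau V) (S (tau X))) : exists u, th \oc u = w.
  have ps : scalar (fun g : mor X V => tr (w \oc fmap tau g)).
    by move=> a u v; rewrite fmapD fmapZ compDr compZr /serre_trace dual_scalar.
  have [v vP] := tr_surj (dual_mk ps); exists (fmap tau v).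
  apply/eqP; rewrite -subr_eq0; apply/eqP/tr_inj => g.
  have [g' <-] := tfu _ _ g.
  rewrite compDl compNl trB -compA -fmapM thP vP.
  exact: subrr.
have [d [cd dc]] := ci (S (tau X)).
have [u uP] := surj _ (c (S (tau X))).
exists (u \oc d); split; last by rewrite compA uP.
have e : th \oc (u \oc d \oc th - idm _) = 0.
  by rewrite compDr compNr !compA uP dc comp1m compm1 subrr.
by apply/eqP; rewrite -subr_eq0; apply/eqP/inj.
Qed.

(** As S = tau [1], the map of [serre_twist] goes from tau (tau X[1]) to tau ((tau X)[1]), and the
    outer tau cancels. Naturality is tested under traces, where both sides become tr (k f). *)
Lemma tau_shift_comm : fiso (fcomp tau sh) (fcomp sh tau).
Proof.
have tfa := @ae_faithful _ _ tau; have tfu := @ae_full _ _ tau.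
have ex X : exists c : mor (tau (sh X)) (sh (tau X)),
    forall k : mor X (S X), tr ((fmap tau c : mor _ (S (tau X))) \oc fmap tau k) = tr k.
  have [th thP] := serre_twist X; have [c cP] := tfu _ _ th.
  by exists c => k; rewrite cP.
pose c X := sval (cid (ex X)); have cP X := svalP (cid (ex X)) : forall k, _ = _.
exists c; split=> [X Y f|X]; last first.
  exact/(ff_is_iso tfu tfa)/(serre_twist_iso (cP X)).
apply: (faithful_inj tfa); apply/eqP; rewrite -subr_eq0; apply/eqP.
apply: (tr_inj (X := tau Y)) => g; have [k <-] := tfu _ _ g.
rewrite compDl compNl trB !fmapM.
have := cP Y (fmap S f \oc k); rewrite fmapM compA => ->; rewrite -trC.
rewrite -[in X in _ - X]compA.
have := trC (X := tau X) (fmap tau f)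
  ((fmap tau (c X) : mor _ (S (tau X))) \oc fmap tau k).
by rewrite /= => <-; rewrite -compA -fmapM cP subrr.
Qed.

Lemma serre_dual_bimod T :
  exists Phi : mor T (ae_inv tau (sh T)) -> dual (mor T (tau (tau T))),
  [/\ linear Phi, bijective Phi,
      forall (a : mor T T) f m,
        Phi (fmap (ae_inv tau) (fmap sh a) \oc f) m = Phi f (m \oc a)
    & forall (a : mor T T) f m, Phi (f \oc a) m = Phi f (fmap tau (fmap tau a) \oc m)].
Proof.
have tfa := @ae_faithful _ _ tau; have tfu := @ae_full _ _ tau.
have shfa := sh_faithful; have shfu := sh_full.
have [c [cn ci]] := tau_shift_comm; have [e [en ei]] := ae_counit tau.
have [d [dc cd]] := ci (tau T).
have dn (a : mor T T) : fmap tau (fmap sh (fmap tau a)) \oc d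
    = d \oc fmap sh (fmap tau (fmap tau a)).
  have := cn _ _ (fmap tau a); rewrite /= => /(congr1 (fun u => d \oc u \oc d)).
  by rewrite !compA dc comp1m -!compA cd compm1.
have [e' [e'e ee']] := ei (sh T).
(* [adj] moves tau^-1 to the other side as tau; [pr] is then the Serre pairing at tau T, with [d]
   identifying (tau^2 T)[1] with S (tau T). *)
pose adj (f : mor T (ae_inv tau (sh T))) : mor (tau T) (sh T) := e (sh T) \oc fmap tau f.
pose pr (f : mor T (ae_inv tau (sh T))) (m : mor T (tau (tau T))) : K :=
  tr (d \oc fmap sh m \oc adj f : mor (tau T) (S (tau T))).
have prs f : scalar (pr f).
  move=> a u v; rewrite /pr fmapD fmapZ compDr compZr compDl compZl.
  by rewrite /serre_trace dual_scalar.
pose Phi f := dual_mk (prs f).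
have Plin : linear Phi.
  move=> a u v; apply: dual_eq => m; rewrite dualDE dualZE.
  rewrite -[LHS]/(pr _ _) /pr /adj fmapD fmapZ !compDr !compZr.
  by rewrite /serre_trace dual_scalar.
exists Phi; split=> // [|a f m|a f m].
- have Pinj : injective Phi.
    move=> f g fg; apply/eqP; rewrite -subr_eq0; apply/eqP.
    have P0 m : pr (f - g) m = 0.
      have -> : f - g = -1 *: g + f by rewrite scaleN1r addrC.
      by rewrite -[LHS]/(Phi _ m) Plin fg dualDE dualZE mulN1r addNr.
    suff : adj (f - g) = 0.
      by move=> /(mono_zero (is_iso_mono (ei _)))/tfa.
    apply: phi_inj => h; have [m mh] := shfu _ _ (c (tau T) \oc h).
    by have := P0 m; rewrite /pr mh compA dc comp1m.
  have Psurj p : exists f, Phi f = p.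
    pose inv (h : mor (sh T) (S (tau T))) := sval (cid (shfu _ _ (c (tau T) \oc h))).
    have invP h : fmap sh (inv h) = c (tau T) \oc h := svalP (cid (shfu _ _ _)).
    have ps : scalar (fun h => p (inv h)).
      move=> a u v; rewrite -dual_scalar; congr (p _).
      by apply: (faithful_inj shfa); rewrite fmapD fmapZ !invP compDr compZr.
    have [g gP] := phi_surj (dual_mk ps).
    have [f fP] := tfu _ _ (e' \oc g).
    exists f; apply: dual_eq => m; rewrite -[LHS]/(pr f m) /pr /adj fP.
    rewrite !compA -(compA _ _ e') ee' compm1 gP; congr (p _).
    by apply: (faithful_inj shfa); rewrite invP compA cd comp1m.
  exists (fun p => sval (cid (Psurj p))) => [f|p]; last exact: svalP (cid (Psurj p)).
  exact/Pinj/(svalP (cid (Psurj (Phi f)))).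
- rewrite -[LHS]/(pr _ _) -[RHS]/(pr _ _) /pr /adj; congr (tr _).
  have /= en' := en _ _ (fmap sh a).
  by rewrite !fmapM !compA -(compA _ _ (fmap tau (fmap _ _))) en' !compA.
(* By [trC] the endomorphism leaves on the right as tau a and returns on the left as S (tau a),
   which [dn] turns into tau^2 a acting on [m]. *)
- rewrite -[LHS]/(pr _ _) -[RHS]/(pr _ _) /pr /adj fmapM !compA trC.
  by congr (tr _); rewrite /= !compA dn fmapM !compA.
Qed.

End Serre.

(** * Truncations of complexes *)

Lemma NegzS (n : nat) : Negz n.+1 + 1 = Negz n :> int.
Proof. lia. Qed.

Section Complexes.
Variables (K : fieldType) (H : abcat K).
Implicit Types (C X Y : cplx H) (V : H).

Definition nonneg C : Prop := forall n : nat, is_zero (C (Negz n)).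

Lemma nonneg_succ C n : nonneg C -> is_zero (C (Negz n.+1 + 1)).
Proof. by move=> C0; rewrite NegzS. Qed.

Section Trunc.
Variable C : cplx H.

Local Notation dm1 := (cd C (Negz 0) : mor (C (Negz 0)) (C (Posz 0))).
Let coker_ex := cid (ab_coker dm1).
Definition trunc_coker : H := sval coker_ex.
Definition trunc_proj : mor (C (Posz 0)) trunc_coker := sval (cid (svalP coker_ex)).
Lemma trunc_projP : is_cokernel dm1 trunc_proj.
Proof. exact: svalP (cid (svalP coker_ex)). Qed.

Lemma trunc_d0_ex :
  exists d : mor trunc_coker (C (Posz 1)), d \oc trunc_proj = cd C (Posz 0).
Proof. by apply: (cokernel_desc trunc_projP); apply: (cdd C (Negz 0)). Qed.
Definition trunc_d0 := sval (cid trunc_d0_ex).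
Lemma trunc_d0P : trunc_d0 \oc trunc_proj = cd C (Posz 0).
Proof. exact: svalP (cid trunc_d0_ex). Qed.

(** The canonical truncation: the cokernel of d^-1 in degree 0 keeps the cohomology in degrees at
    least 0. *)
Definition trunc_cx (i : int) : H :=
  match i with
  | Posz 0 => trunc_coker | Posz n.+1 => C (Posz n.+1) | Negz _ => zero_ob H
  end.
Definition trunc_cd (i : int) : mor (trunc_cx i) (trunc_cx (i + 1)) :=
  match i with
  | Posz 0 => trunc_d0 | Posz n.+1 => cd C (Posz n.+1) | Negz _ => 0
  end.
Lemma trunc_dd i : trunc_cd (i + 1) \oc trunc_cd i = 0.
Proof.
case: i => [[|n]|n]; last by rewrite compm0.
  apply: (cokernel_epi trunc_projP); rewrite comp0m -compA.
  have -> : trunc_cd 0 \oc trunc_proj = cd C 0 := trunc_d0P.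
  exact: (cdd C (Posz 0)).
exact: (cdd C (Posz n.+1)).
Qed.
Lemma trunc_bounded :
  exists n : nat, forall i : int, (n < `|i|)%N -> is_zero (trunc_cx i).
Proof.
have [n nP] := cx_bounded C; exists n => -[[|m]|m] //; first exact: nP.
by move=> _; apply: zero_obP.
Qed.
Definition trunc : cplx H := Cplx trunc_dd trunc_bounded.

Lemma trunc_nonneg : nonneg trunc.
Proof. by move=> n; apply: zero_obP. Qed.

Definition trunc_fun (i : int) : mor (C i) (trunc i) :=
  match i with
  | Posz 0 => trunc_proj | Posz n.+1 => idm (C (Posz n.+1)) | Negz _ => 0
  end.
Lemma trunc_fun_comm i :
  cd trunc i \oc trunc_fun i = trunc_fun (i + 1) \oc cd C i.
Proof.
case: i => [[|n]|[|n]].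
- by rewrite [LHS]trunc_d0P; apply/esym/comp1m.
- by rewrite [LHS]compm1; apply/esym/comp1m.
- by rewrite compm0; case: trunc_projP => -> _.
by rewrite [LHS](zero_cod _ (nonneg_succ n trunc_nonneg)) [RHS]zero_cod //;
  apply: nonneg_succ trunc_nonneg.
Qed.
Definition trunc_map : chain C trunc := chain_mk trunc_fun_comm.

(** [acyclic_at C (Negz n.+1)] is exactness in degree -(n + 1), so the assumption covers exactly the
    negative degrees. *)
Lemma trunc_qis : (forall n, acyclic_at C (Negz n.+1)) -> quasi_iso trunc_map.
Proof.
move=> ac; apply/quasi_isoP; split=> [[[|n]|[|n]]|[[|n]|[|n]]] V.
- move=> x y dx fx.
  have [V' [e [w [ee wP]]]] := epi_pullback y (cokernel_epi trunc_projP).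
  exists V', e, w; split=> //.
  rewrite -[cd C _]trunc_d0P -compA wP compA -[X in X \oc _]fx.
  by congr (_ \oc _); apply: comp1m.
- move=> x y dx fx; exists V, (idm V), y; split; first exact: epi_id.
  by rewrite compm1 -[RHS]comp1m; apply/esym.
- move=> x y dx fx; apply: (exact_lift trunc_projP).
  by rewrite [LHS]fx [y]zero_cod ?compm0 //; apply: zero_obP.
- by move=> x y dx _; apply: ac.
- move=> y dy; exists V, (idm V), y, 0; split=> //; first exact: epi_id.
  by rewrite compm0 addr0 compm1; apply: comp1m.
- move=> y dy; exists V, (idm V), y, 0; split=> //; first exact: epi_id.
  by rewrite compm0 addr0 compm1; apply: comp1m.
- move=> y dy.
  have [V' [e [x [ee xP]]]] := epi_pullback y (cokernel_epi trunc_projP).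
  exists V', e, x, 0; split=> //; last by rewrite compm0 addr0.
  have dE : cd C (Negz 0 + 1) = trunc_d0 \oc trunc_proj := esym trunc_d0P.
  by rewrite dE -compA xP compA [trunc_d0 \oc y]dy comp0m.
- have z := nonneg_succ n trunc_nonneg.
  move=> y _; exists V, (idm V), 0, 0; split; [exact: epi_id|exact: compm0|].
  by rewrite [LHS](zero_cod _ z) [RHS](zero_cod _ z).
Qed.
End Trunc.

Section Brutal.
Variable C : cplx H.

(** The brutal truncation in degrees at least 1; for nonnegative C the quotient by this subcomplex
    is the stalk of C^0. *)
Definition brutal_cx (i : int) : H :=
  match i with Posz n.+1 => C (Posz n.+1) | _ => zero_ob H end.
Definition brutal_cd (i : int) : mor (brutal_cx i) (brutal_cx (i + 1)) :=
  match i with Posz n.+1 => cd C (Posz n.+1) | _ => 0 end.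
Lemma brutal_dd i : brutal_cd (i + 1) \oc brutal_cd i = 0.
Proof.
by case: i => [[|n]|n]; [rewrite compm0 | apply: (cdd C (Posz n.+1)) | rewrite compm0].
Qed.
Lemma brutal_bounded :
  exists n : nat, forall i : int, (n < `|i|)%N -> is_zero (brutal_cx i).
Proof.
have [n nP] := cx_bounded C; exists n => -[[|m]|m] //; first exact: nP.
by move=> _; apply: zero_obP.
Qed.
Definition brutal : cplx H := Cplx brutal_dd brutal_bounded.

Definition brutal_in (i : int) : mor (brutal i) (C i) :=
  match i with Posz n.+1 => idm (C (Posz n.+1)) | _ => 0 end.
(** Only a degreewise retraction: in general it fails to commute with d^0. This defect is what [g0]
    collects below. *)
Definition brutal_ret (i : int) : mor (C i) (brutal i) :=
  match i with Posz n.+1 => idm (C (Posz n.+1)) | _ => 0 end.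
Lemma brutal_in_comm i : cd C i \oc brutal_in i = brutal_in (i + 1) \oc cd brutal i.
Proof.
case: i => [[|n]|n]; first by rewrite !compm0.
  by rewrite [LHS]compm1; apply/esym/comp1m.
by rewrite !compm0.
Qed.
Definition brutal_map : chain brutal C := chain_mk brutal_in_comm.

Lemma brutal_ret_comm n i : i = Posz n.+1 ->
  cd brutal i \oc brutal_ret i = brutal_ret (i + 1) \oc cd C i.
Proof. by move=> ->; rewrite [LHS]compm1; apply/esym/comp1m. Qed.

Hypothesis C0 : nonneg C.
Lemma head_comm i :
  cd (stalk_ob (C (Posz 0))) i
    \oc (match i return mor (C i) (stalk_cx (C (Posz 0)) i) with
         Posz 0 => idm (C (Posz 0)) | _ => 0 end)
  = (match i + 1 as j return mor (C j) (stalk_cx (C (Posz 0)) j) with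
     Posz 0 => idm (C (Posz 0)) | _ => 0 end) \oc cd C i.
Proof.
case: i => [[|n]|n]; [by rewrite !comp0m | by rewrite !comp0m |].
by rewrite [LHS](zero_dom _ (C0 n)) [RHS](zero_dom _ (C0 n)).
Qed.
Definition head_map : chain C (stalk_ob (C (Posz 0))) := chain_mk head_comm.

(* Extend the homotopy by zero to C^0 and subtract its boundary from f; what is
   left lives in degree 0. *)
Lemma nullhomotopic_brutal W (f : chain C W) :
  homotopic (chain_comp f brutal_map) 0 ->
  exists g : chain (stalk_ob (C (Posz 0))) W, homotopic f (chain_comp g head_map).
Proof.
move=> [h hP]; pose h' i : mor (C (i + 1)) (W i) := h i \oc brutal_ret (i + 1).
pose g0 : mor (C (Posz 0)) (W (Posz 0)) := f (Posz 0) - h' (Posz 0) \oc cd C (Posz 0).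
pose gf i : mor (stalk_cx (C (Posz 0)) i) (W i) :=
  match i with Posz 0 => g0 | _ => 0 end.
have hP1 i : f (i + 1) \oc brutal_in (i + 1)
    = cd W i \oc h i + h (i + 1) \oc cd brutal (i + 1).
  by rewrite -hP; apply/esym/subr0.
have gc i : cd W i \oc gf i = gf (i + 1) \oc cd (stalk_ob (C (Posz 0))) i.
  rewrite [RHS]compm0; case: i => [[|n]|n]; rewrite /gf ?compm0 // /g0.
  rewrite compDr compNr chain_comm; have := hP1 (Posz 0).
  rewrite [LHS]compm1 => ->; have -> : h' (Posz 0) = h (Posz 0) := compm1 _.
  have e (d : mor (C 0) (C 1)) (u : mor (C 1) (W 0)) (v : mor (C 2) (W 1))
      (d' : mor (C 1) (C 2)) (dW : mor (W 0) (W 1)) :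
    d' \oc d = 0 -> (dW \oc u + v \oc d') \oc d - dW \oc (u \oc d) = 0.
    by move=> d'd; rewrite compDl -!compA d'd compm0 addr0 subrr.
  exact: e (cdd C 0).
pose g := @chain_mk _ _ (stalk_ob (C (Posz 0))) W gf gc.
exists g, h' => i.
have fE (m : nat) j : j = Posz m.+1 ->
    f j - chain_comp g head_map j = f j \oc brutal_in j \oc brutal_ret j.
  move=> ->; rewrite [X in _ - X](_ : _ = 0); last exact: comp0m.
  by rewrite subr0 -compA comp1m; apply/esym/compm1.
case: i => [n|[|n]]; last by rewrite [LHS](zero_dom _ (nonneg_succ n C0)) [RHS]zero_dom //;
    apply: nonneg_succ C0.
  have n1 : Posz n + 1 = Posz n.+1 by lia.
  rewrite [LHS](fE _ _ n1) hP1 compDl /h' -!compA; congr (_ + _ \oc _).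
  exact: brutal_ret_comm n1.
rewrite (_ : h' (Negz 0) = 0) ?compm0 ?add0r; last exact: compm0.
rewrite [X in _ - X](_ : _ = g0); last exact: compm1.
exact: subKr.
Qed.
End Brutal.
End Complexes.

(** * The derived category *)

Section QuasiIso.
Variables (K : fieldType) (H : abcat K).
Implicit Types (C W X Y Z : cplx H) (V : H).

Lemma quasi_iso_id X : quasi_iso (chain_id X).
Proof.
apply/quasi_isoP; split=> i V.
  move=> x y dx xy; exists V, (idm V), y; split; first exact: epi_id.
  by rewrite -xy compm1; apply: comp1m.
move=> y dy; exists V, (idm V), y, 0; split=> //; first exact: epi_id.
by rewrite compm0 addr0 compm1; apply: comp1m.
Qed.

Lemma quasi_iso_comp X Y Z (g : chain Y Z) (f : chain X Y) :
  quasi_iso g -> quasi_iso f -> quasi_iso (chain_comp g f).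
Proof.
move=> /quasi_isoP[gi gs] /quasi_isoP[fi fs]; apply/quasi_isoP; split=> i V.
  move=> x y dx; rewrite -[X in X \oc x]/(g (i + 1) \oc f (i + 1)) -compA => gfx.
  have [|V1 [e1 [w1 [e1e w1P]]]] := gi i V _ y _ gfx.
    by rewrite compA chain_comm -compA dx compm0.
  have [||V2 [e2 [w2 [e2e w2P]]]] := fi i V1 (x \oc e1) w1.
  - by rewrite compA dx comp0m.
  - by rewrite w1P compA.
  by exists V2, (e1 \oc e2), w2; rewrite compA; split=> //; apply: epi_comp.
move=> z dz; have [V1 [e1 [y [w1 [e1e dy yP]]]]] := gs i V z dz.
have [V2 [e2 [x [w2 [e2e dx xP]]]]] := fs i V1 y dy.
exists V2, (e1 \oc e2), x, (g i \oc w2 + w1 \oc e2); split=> //.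
  exact: epi_comp.
rewrite compA -yP -[X in X \oc x]/(g (i + 1) \oc f (i + 1)) compDl -[g _ \oc y \oc _]compA.
by rewrite -xP !compDr !compA chain_comm addrA.
Qed.

Lemma acyclic_qis X Y (s : chain X Y) i :
  quasi_iso s -> acyclic_at X i -> acyclic_at Y i.
Proof.
move=> /quasi_isoP[_ ss] ac V y dy.
have [V1 [e1 [x [w1 [e1e dx xP]]]]] := ss i V y dy.
have [V2 [e2 [w2 [e2e wP]]]] := ac V1 x dx.
exists V2, (e1 \oc e2), (s i \oc w2 + w1 \oc e2); split; first exact: epi_comp.
by rewrite [RHS]compA -xP compDr compDl !compA chain_comm -!compA wP.
Qed.

Lemma nonneg_acyclic X n : nonneg X -> acyclic_at X (Negz n.+1).
Proof.
move=> X0 V x _; exists V, (idm V), 0; split; first exact: epi_id.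
by rewrite [LHS](zero_cod _ (nonneg_succ n X0)) [RHS](zero_cod _ (nonneg_succ n X0)).
Qed.

Definition concentrated V (j : int) X : Prop :=
  (forall i, j != i -> is_zero (X i)) /\ iso V (X j).

Lemma stalk_concentrated V : concentrated V 0 (stalk_ob V).
Proof.
by split=> [[[|n]|n] // _|]; [apply: zero_obP | apply: zero_obP | apply: iso_refl].
Qed.

Lemma shift_concentrated V j X :
  concentrated V j X -> concentrated V (j - 1) (shift_ob X).
Proof.
move=> [X0 Xj]; split=> [i ji|]; last by rewrite [shift_ob X _]/(X (j - 1 + 1)) subrK.
by apply: X0; apply: contraNneq ji => ->; rewrite addrK.
Qed.

Lemma iter_shift_concentrated V n :
  concentrated V (- n%:Z) (iter n (cplx_shift H) (stalk_ob V)).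
Proof.
elim: n => [|n IHn]; first by rewrite oppr0; apply: stalk_concentrated.
have -> : - n.+1%:Z = - n%:Z - 1 by lia.
exact: shift_concentrated.
Qed.

Lemma concentrated_map X Y j (y : mor (X j) (Y j)) :
  (forall i, j != i -> is_zero (X i)) -> cd Y j \oc y = 0 ->
  exists f : chain X Y, f j = y.
Proof.
move=> X0 dy.
pose f i : mor (X i) (Y i) :=
  if (j =P i) is ReflectT e then ecast k (mor (X k) (Y k)) e y else 0.
have fj : f j = y.
  by rewrite /f; case: (j =P j) => // e; rewrite (eq_axiomK e).
have fc i : cd Y i \oc f i = f (i + 1) \oc cd X i.
  have [ji|/X0 z] := eqVneq j i; last by rewrite [LHS](zero_dom _ z) [RHS](zero_dom _ z).
  have z : is_zero (X (i + 1)) by apply: X0; lia.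
  by rewrite (zero_dom (f (i + 1)) z) comp0m; case: _ / ji; rewrite fj.
by exists (chain_mk fc).
Qed.

End QuasiIso.

Section Derived.
Variables (K : fieldType) (H : abcat K) (D : derived_cat H).
Implicit Types (C X Y : cplx H) (V : H) (Z W : D).
Local Notation Q := (dQ D).
Local Notation sh := (dshift D).
Local Notation incl := (incl D).

Lemma qis_iso (X Y : cplx_cat H) (s : mor X Y) :
  quasi_iso s -> is_iso (fmap Q s).
Proof. exact: dQ_qis. Qed.

Lemma dQ_comp X Y T (g : chain Y T) (f : chain X Y) :
  fmap Q (chain_comp g f : @mor _ (cplx_cat H) X T)
  = fmap Q (g : @mor _ (cplx_cat H) Y T) \oc fmap Q (f : @mor _ (cplx_cat H) X Y).
Proof. exact: fmapM. Qed.

Lemma dQ_homotopic X Y (f g : chain X Y) :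
  homotopic f g ->
  fmap Q (f : @mor _ (cplx_cat H) X Y) = fmap Q (g : @mor _ (cplx_cat H) X Y).
Proof.
move=> fg; apply/dQ_eq; exists Y, (chain_id Y); split; first exact: quasi_iso_id.
have : homotopic (chain_comp (chain_id Y) f) (chain_comp (chain_id Y) g).
  by rewrite !chain_comp1m.
exact.
Qed.

Lemma dQ_null X Y (f : chain X Y) : fmap Q (f : @mor _ (cplx_cat H) X Y) = 0 ->
  exists (T : cplx H) (s : chain Y T), quasi_iso s /\ homotopic (chain_comp s f) 0.
Proof.
rewrite -[RHS](fmap0 Q) => /dQ_eq[Z [s [sq sf]]]; exists Z, s; split=> //.
by move: sf; rewrite compm0.
Qed.

(** The apex of a fraction is quasi-isomorphic to Y, hence acyclic in negative degrees, and may be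
    replaced by its truncation. *)
Lemma roof_nonneg X Y (g : mor (Q X) (Q Y)) : nonneg Y ->
  exists (Z : cplx_cat H) (f : mor (X : cplx_cat H) Z) (s : mor (Y : cplx_cat H) Z),
    [/\ nonneg Z, quasi_iso s & fmap Q s \oc g = fmap Q f].
Proof.
move=> Y0; have [Z [f [s [sq gP]]]] := dQ_full g.
pose t : mor Z (trunc Z : cplx_cat H) := trunc_map Z.
exists (trunc Z), (t \oc f), (t \oc s); split; first exact: trunc_nonneg.
  apply: quasi_iso_comp => //; apply: trunc_qis => n.
  exact/(acyclic_qis sq)/nonneg_acyclic.
by rewrite !fmapM -compA gP.
Qed.

Lemma dshift_iter n X : iso (iter n sh (Q X)) (Q (iter n (cplx_shift H) X)).
Proof.
elim: n => [|n IHn]; first exact: iso_refl.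
apply: (iso_trans (fmap_iso sh IHn)).
exact: (fiso_iso (iter n (cplx_shift H) X) (dshiftQ D)).
Qed.

Lemma iter_shift_iso n Z W : iso Z W -> iso (iter n sh Z) (iter n sh W).
Proof. by move=> ZW; elim: n => //= n; apply: fmap_iso. Qed.

Definition coconnective Z : Prop :=
  forall V n, hom_zero (iter n.+1 sh (incl V)) Z.

Lemma coconnective_iso Z W : iso Z W -> coconnective Z -> coconnective W.
Proof. by move=> ZW Z0 V n; apply: hom_zero_iso (Z0 V n) => //; apply: iso_refl. Qed.

Lemma nonneg_coconnective C : nonneg C -> coconnective (Q C).
Proof.
move=> C0 V n; apply: (hom_zero_iso (iso_sym (dshift_iter _ _)) (iso_refl _)) => g.
have [Z [f [s [Z0 sq sg]]]] := roof_nonneg g C0.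
apply: (mono_zero (is_iso_mono (qis_iso sq))); rewrite sg.
rewrite (_ : f = 0) ?fmap0 //; apply: chain_eq => i.
have [X0 _] := iter_shift_concentrated V n.+1.
have [iE|/X0 Xi] := eqVneq (- n.+1%:Z) i; last first.
  by rewrite [LHS](zero_dom _ Xi) [RHS](zero_dom _ Xi).
have Zi : is_zero ((Z : cplx H) i) by rewrite -iE -NegzE; apply: Z0.
by rewrite [LHS](zero_cod _ Zi) [RHS](zero_cod _ Zi).
Qed.

(** A cycle on V in degree -(n + 1) is a map V[n + 1] -> C, which vanishes in D. Some
    quasi-isomorphism [s] thus makes it null-homotopic, the homotopy shows that s x is a boundary,
    and [s] is injective on cohomology. *)
Lemma coconnective_acyclic C n : coconnective (Q C) -> acyclic_at C (Negz n.+1).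
Proof.
move=> C0 V x dx.
pose X := iter n.+1 (cplx_shift H) (stalk_ob V).
have [X0 Xn] : concentrated V (Negz n.+1 + 1) X.
  by have := iter_shift_concentrated V n.+1; rewrite NegzS NegzE.
have [a [b [ba ab]]] := Xn.
have [|f fP] := concentrated_map (y := x \oc b) X0; first by rewrite compA dx comp0m.
have f0 : fmap Q (f : @mor _ (cplx_cat H) X C) = 0.
  exact: (hom_zero_iso (dshift_iter n.+1 (stalk_ob V)) (iso_refl _) (C0 V n)).
have [Y [s [/quasi_isoP[si _] [h hP]]]] := dQ_null f0.
apply: (si _ _ x (h (Negz n.+1) \oc a)) => //.
have := hP (Negz n.+1); rewrite subr0 -[LHS]/(s _ \oc f _) fP.
have Xz : is_zero ((X : cplx H) (Negz n.+1 + 1 + 1)) by apply: X0; lia.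
rewrite (zero_cod (cd X _) Xz) compm0 addr0 => /(congr1 (fun u => u \oc a)).
by rewrite -!compA ba compm1.
Qed.

Lemma coconnective_nonneg Z : coconnective Z -> exists2 C, nonneg C & iso (Q C) Z.
Proof.
move=> Z0; have [C CZ] := dQ_surj Z.
have C0 := coconnective_iso (iso_sym CZ) Z0.
exists (trunc C); first exact: trunc_nonneg.
apply: iso_trans CZ; apply: iso_sym.
exists (fmap Q (trunc_map C : @mor _ (cplx_cat H) C (trunc C))).
by apply/qis_iso/trunc_qis => n; apply: coconnective_acyclic.
Qed.

Lemma stalk_nonneg V : nonneg (stalk_ob V).
Proof. by move=> n; apply: zero_obP. Qed.

Lemma incl_coconnective V : coconnective (incl V).
Proof. exact/nonneg_coconnective/stalk_nonneg. Qed.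

(** A map that vanishes in D becomes a boundary after a quasi-isomorphism, hence is one on a cover;
    a stalk complex has no nonzero boundaries. *)
Lemma incl_faithful : faithful incl.
Proof.
move=> X Y f /dQ_null[Z [s [/quasi_isoP[si _] [h hP]]]].
have := hP (Negz 0); rewrite [cd (stalk_ob _) _]/(0 : mor _ _) compm0 addr0 subr0 => sf.
have [|V [e [w [ee wP]]]] := si (Negz 0) X f (h (Negz 0)) (comp0m _ _).
  exact: sf.
apply: (epi_zero ee); rewrite -[LHS]wP; exact: comp0m.
Qed.

(** Take a fraction X -> Z <- Y with Z nonnegative. Its denominator identifies Y with the kernel of
    d^0 on Z: monic by injectivity on H^0, and covering all cycles by surjectivity. The numerator
    lands in that kernel. *)
Lemma incl_full : full incl.
Proof.
move=> X Y g; have [Z [f [s [Z0 sq sg]]]] := roof_nonneg g (@stalk_nonneg Y).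
have /quasi_isoP[si ss] := sq.
pose f0 : mor X ((Z : cplx H) 0) := (f : chain _ _) 0.
pose s0 : mor Y ((Z : cplx H) 0) := (s : chain _ _) 0.
have s0m : is_mono s0.
  apply: zero_mono => V x sx.
  have [|V' [e [w [ee wP]]]] := si (Negz 0) V x 0 (comp0m _ _).
    by rewrite compm0; apply: sx.
  by apply: (epi_zero ee); rewrite -[LHS]wP; apply: comp0m.
have df0 : cd (Z : cplx H) (Negz 0 + 1) \oc f0 = 0.
  by rewrite [LHS](chain_comm (f : chain _ _) 0) compm0.
have [V [e [x [w [ee _ xP]]]]] := ss (Negz 0) X f0 df0.
have sx : s0 \oc x = f0 \oc e.
  by rewrite -[RHS]xP (zero_cod w (Z0 0%N)) compm0 addr0.
have [u uP] := mono_descend s0m ee sx.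
exists u; apply: (is_iso_mono (qis_iso sq)).
rewrite sg (_ : fmap Q s \oc _ = fmap Q (s \oc fmap (stalk H) u)); last by rewrite fmapM.
congr (fmap Q _); apply: chain_eq => -[[|n]|n]; first exact: uP.
  by rewrite [LHS]compm0 [RHS]zero_dom //; apply: zero_obP.
by rewrite [LHS]compm0 [RHS]zero_dom //; apply: zero_obP.
Qed.

(** Replaces the exact Hom sequence of the triangle brutal C -> C -> C^0. *)
Lemma brutal_hom_zero C W : nonneg C ->
  hom_zero (Q (brutal C)) W -> hom_zero (incl (C 0)) W -> hom_zero (Q C) W.
Proof.
move=> C0; have [Y YW] := dQ_surj W.
move=> /(hom_zero_iso (iso_refl _) (iso_sym YW)) B0.
move=> /(hom_zero_iso (iso_refl _) (iso_sym YW)) H0.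
apply: (hom_zero_iso (iso_refl _) YW) => g.
have [Z [f [s [sq sg]]]] := dQ_full g.
pose b : @mor _ (cplx_cat H) (brutal C) C := brutal_map C.
have fb0 : fmap Q (f \oc b) = 0 by rewrite fmapM -sg -compA (B0 (g \oc _)) compm0.
have [Z' [s' [s'q fbh]]] := dQ_null fb0.
have sq' : quasi_iso (chain_comp s' s) by apply: quasi_iso_comp.
pose f' : chain C Z' := chain_comp s' f.
have : homotopic (chain_comp f' (brutal_map C)) 0.
  by rewrite /f' -chain_compA.
move=> /(nullhomotopic_brutal C0)[k /dQ_homotopic kP].
apply: (mono_zero (is_iso_mono (qis_iso sq'))).
have -> : fmap Q (chain_comp s' s : @mor _ (cplx_cat H) Y Z') \oc g
    = fmap Q (f' : @mor _ (cplx_cat H) C Z').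
  by rewrite !dQ_comp -compA sg.
have [t [_ st]] := qis_iso sq'.
rewrite kP dQ_comp -[X in X \oc _]comp1m -st -(compA _ t) (H0 (t \oc _)).
by rewrite !compm0 comp0m.
Qed.

Hypothesis sh_fa : faithful sh.

Lemma shift_brutal_nonneg C : nonneg (shift_ob (brutal C)).
Proof.
case=> [|n]; first exact: zero_obP.
have -> : shift_ob (brutal C) (Negz n.+1) = brutal C (Negz n).
  exact: (congr1 (brutal C) (NegzS n)).
exact: zero_obP.
Qed.

(** Induction on the length: (brutal C)[1] is again nonnegative and one step shorter, and the shift
    reappears on W. *)
Lemma nonneg_hom_zero C W : nonneg C ->
  (forall j : nat, hom_zero (incl (C j)) (iter j sh W)) -> hom_zero (Q C) W.
Proof.
move=> C0.
have : exists n : nat, forall i : nat, (n <= i)%N -> is_zero (C i).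
  by have [n nP] := cx_bounded C; exists n.+1 => i; apply: (nP i).
case=> n; elim: n C C0 W => [|n IHn] C C0 W Cn CW.
  have C1 : idm (C : cplx_cat H) = 0.
    by apply: chain_eq => -[i|i]; [apply: Cn | apply: C0].
  by move=> f; apply: zero_dom; rewrite /is_zero -(fmap1 Q) C1 fmap0.
apply: brutal_hom_zero => //; last exact: (CW 0%N).
apply: (fmap_hom_zero sh_fa).
apply: (hom_zero_iso (iso_sym (fiso_iso (brutal C : cplx_cat H) (dshiftQ D))) (iso_refl _)).
have e (j : nat) : Posz j + 1 = Posz j.+1 by lia.
apply: IHn => [|i ni|j]; first exact: shift_brutal_nonneg.
  have -> : shift_ob (brutal C) i = C (Posz i.+1) := congr1 (brutal C) (e i).
  exact/Cn.
have -> : shift_ob (brutal C) j = C (Posz j.+1) := congr1 (brutal C) (e j).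
by rewrite -iterSr; apply: CW.
Qed.

Lemma coconnective_hom_zero Z V m : hereditary D -> (2 <= m)%N ->
  coconnective Z -> hom_zero Z (iter m sh (incl V)).
Proof.
move=> [Ext0 _ _] m2 /coconnective_nonneg[C C0 CZ].
apply: (hom_zero_iso CZ (iso_refl _)); apply: nonneg_hom_zero => // j e.
rewrite -iterD in e *; apply: Ext0; exact: leq_trans m2 (leq_addl _ _).
Qed.

End Derived.

(** * Splitting off the lowest cohomology *)

Section Aug.
Variables (K : fieldType) (H : abcat K).
Implicit Types (X Y : cplx H) (V : H).

Lemma acyclic_shift X i : acyclic_at X (i + 1) -> acyclic_at (shift_ob X) i.
Proof.
move=> ac V x; rewrite compNl => /eqP; rewrite oppr_eq0 => /eqP dx.
have [V' [e [w [ee wP]]]] := ac V x dx.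
by exists V', e, (- w); rewrite compNl compNr opprK.
Qed.

Lemma stalk_zero V i : i != 0 -> is_zero (stalk_cx V i).
Proof. by case: i => [[|i]|i] // _; apply: zero_obP. Qed.

Variables (C : cplx H) (V : H) (k : mor V (C 0)).
Hypothesis dk : cd C 0 \oc k = 0.

(* The cone of V -> C, with V in degree -1. *)
Definition aug_cx (i : int) : H :=
  match i with Posz n => C (Posz n) | Negz 0 => V | _ => zero_ob H end.
Definition aug_cd (i : int) : mor (aug_cx i) (aug_cx (i + 1)) :=
  match i with Posz n => cd C (Posz n) | Negz 0 => k | Negz n.+1 => 0 end.
Lemma aug_dd i : aug_cd (i + 1) \oc aug_cd i = 0.
Proof. by case: i => [n|[|n]]; [apply: (cdd C) | apply: dk | rewrite compm0]. Qed.
Lemma aug_bounded :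
  exists n : nat, forall i : int, (n < `|i|)%N -> is_zero (aug_cx i).
Proof.
have [n nP] := cx_bounded C; exists n.+1 => -[m|[|m]] //; last first.
  by move=> _; apply: zero_obP.
by move=> nm; apply: nP; apply: ltn_trans nm.
Qed.
Definition aug : cplx H := Cplx aug_dd aug_bounded.

Definition aug_proj (i : int) : mor (aug i) (shift_ob (stalk_ob V) i) :=
  match i with Negz 0 => idm V | _ => 0 end.
Lemma aug_proj_comm i : cd (shift_ob (stalk_ob V)) i \oc aug_proj i
  = aug_proj (i + 1) \oc cd aug i.
Proof.
rewrite [cd _ i](_ : _ = 0) ?comp0m; last exact: oppr0.
case: i => [n|[|n]]; [by rewrite [RHS]comp0m | by rewrite [RHS]comp0m |].
by rewrite compm0.
Qed.
Definition aug_map : chain aug (shift_ob (stalk_ob V)) := chain_mk aug_proj_comm.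

Definition coaug_fun (i : int) : mor (stalk_ob V i) (C i) :=
  match i with Posz 0 => k | _ => 0 end.
Lemma coaug_comm i :
  cd C i \oc coaug_fun i = coaug_fun (i + 1) \oc cd (stalk_ob V) i.
Proof.
rewrite [RHS]compm0; case: i => [[|n]|n]; first exact: dk.
  exact: compm0.
exact: compm0.
Qed.
Definition coaug : chain (stalk_ob V) C := chain_mk coaug_comm.

Hypothesis C0 : nonneg C.

Lemma aug_acyclic n : is_mono k -> acyclic_at aug (Negz n.+1).
Proof.
move=> km; case: n => [|n] U x dx.
  have x0 : x = 0 := mono_zero km dx.
  by exists U, (idm U), 0; rewrite x0 compm0 comp0m; split=> //; apply: epi_id.
have z : is_zero (aug (Negz n.+2 + 1)) by rewrite NegzS; apply: zero_obP.
exists U, (idm U), 0; split; first exact: epi_id.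
by rewrite [LHS](zero_cod _ z) [RHS](zero_cod _ z).
Qed.

(** When V is all of ker d^0 the cone is acyclic in degree 0 as well, so its shift is still in
    D^(>=0). The extra shift moves the obstruction from V[1] to V[2], where hereditariness kills
    it. *)
Lemma aug_shift_acyclic n : is_kernel (cd C 0) k ->
  acyclic_at (shift_ob aug) (Negz n.+1).
Proof.
move=> kk; apply: acyclic_shift; case: n => [|n].
  move=> U x dx; have [w wP] := kernel_lift kk dx.
  by exists U, (idm U), w; rewrite compm1; split=> //; apply: epi_id.
rewrite NegzS; exact/aug_acyclic/(kernel_mono kk).
Qed.

Variable D : derived_cat H.
Local Notation Q := (dQ D).
Local Notation sh := (dshift D).
Hypotheses (sh_fa : faithful sh) (sh_fu : full sh).

(* A null-homotopy of s o aug_map, for a quasi-isomorphism s : V[1] -> W, is on C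
   a chain map C[1] -> W, whose composite with coaug[1] is homotopic to s. *)
Lemma aug_retract :
  fmap Q (aug_map : @mor _ (cplx_cat H) aug (shift_ob (stalk_ob V))) = 0 ->
  exists r : mor (Q C) (incl D V),
    r \oc fmap Q (coaug : @mor _ (cplx_cat H) (stalk_ob V) C) = idm _.
Proof.
move=> /dQ_null[W [s [sq [h hP]]]].
(* [h i] starts at [aug (i + 1)], which is C[1] in degree i for i >= -1; below that C[1] is zero. *)
pose gf (i : int) : mor (shift_ob C i) (W i) :=
  match i with Posz n => h (Posz n) | Negz 0 => h (Negz 0) | _ => 0 end.
have gc i : cd W i \oc gf i = gf (i + 1) \oc cd (shift_ob C) i.
  rewrite [RHS]compNr; apply/eqP; rewrite -subr_eq0 opprK; apply/eqP.
  case: i => [n|[|n]].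
  - by rewrite -[LHS](hP (Posz n)) subr0; apply: compm0.
  - by rewrite -[LHS](hP (Negz 0)) subr0; apply: compm0.
  have z : is_zero (C (Negz n.+1 + 1)) by rewrite NegzS; apply: C0.
  by rewrite (zero_dom (_ + _) z).
pose g : chain (shift_ob C) W := chain_mk gc.
have sg : homotopic s (chain_comp g (shift_map coaug)).
  (* The one component of [h] that starts at V, in degree -1, is the homotopy. *)
  pose h2 (i : int) : mor (shift_ob (stalk_ob V) (i + 1)) (W i) :=
    match i with Negz 1 => h (Negz 1) | _ => 0 end.
  exists h2 => i; rewrite [cd (shift_ob _) _](_ : _ = 0) ?compm0 ?addr0; last exact: oppr0.
  have [->|ni] := eqVneq i (Negz 1); last first.
    have z : is_zero (shift_ob (stalk_ob V) (i + 1)) by apply: stalk_zero; lia.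
    by rewrite [LHS](zero_dom _ z) [RHS](zero_dom _ z).
  apply/eqP; rewrite subr_eq; apply/eqP.
  by rewrite -[RHS](hP (Negz 1)) subr0; apply/esym/compm1.
have [t [ts _]] := qis_iso D sq.
have := dQ_homotopic D sg; rewrite dQ_comp => sgE.
have [a [an ai]] := dshiftQ D; have [b [ba _]] := ai (stalk_ob V).
have [r rP] := sh_fu (b \oc t \oc fmap Q (g : @mor _ (cplx_cat H) _ _) \oc a C).
exists r; apply: (faithful_inj sh_fa); rewrite fmapM rP fmap1 -!compA.
rewrite (an _ _ (coaug : @mor _ (cplx_cat H) (stalk_ob V) C)).
have -> : fmap (fcomp Q (cplx_shift H)) (coaug : @mor _ (cplx_cat H) (stalk_ob V) C)
  = fmap Q (shift_map coaug
      : @mor _ (cplx_cat H) (shift_ob (stalk_ob V)) (shift_ob C)) by [].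
by rewrite (compA _ _ (a _)) -sgE (compA t) ts comp1m ba.
Qed.

End Aug.

Section Heart.
Variables (K : fieldType) (H : abcat K) (D : derived_cat H).
Local Notation Q := (dQ D).
Local Notation sh := (dshift D).
Local Notation incl := (incl D).
Hypotheses (sh_fa : faithful sh) (sh_fu : full sh).

Lemma trunc_iso (C : cplx H) : (forall n, acyclic_at C (Negz n.+1)) ->
  iso (Q C) (Q (trunc C)).
Proof.
move=> ac; exists (fmap Q (trunc_map C : @mor _ (cplx_cat H) C (trunc C))).
exact/qis_iso/trunc_qis.
Qed.

Lemma cokernel_unique (X Y Z Z' : H) (d : mor X Y) (q : mor Y Z) (q' : mor Y Z') :
  is_cokernel d q -> is_cokernel d q' -> iso Z Z'.
Proof.
move=> qP q'P; have [u uP] := cokernel_desc qP (proj1 q'P).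
have [v vP] := cokernel_desc q'P (proj1 qP).
exists u, v; split.
  by apply: (cokernel_epi qP); rewrite -compA uP vP comp1m.
by apply: (cokernel_epi q'P); rewrite -compA vP uP comp1m.
Qed.

Lemma zero_incl (X : H) : is_zero X -> is_zero (incl X).
Proof. by move=> X0; rewrite /is_zero -fmap1 X0 fmap0. Qed.

(* Pull the epimorphism back to an epimorphism onto X with kernel V; its splitting
   is a retraction of V -> P, obstructed by Hom(X, V[1]). *)
Lemma ext1_projective (X : H) :
  (forall V : H, hom_zero (incl X) (sh (incl V))) -> projective X.
Proof.
move=> X0 A B p f pe.
have [P [q [f' [qe qP]]]] := epi_pullback f pe.
have [V [k kP]] := ab_ker q; pose C := stalk_ob P.
have dk : cd C 0 \oc (k : mor V (C 0)) = 0 := comp0m _ _.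
have kq := epi_cokernel qe kP; have km := kernel_mono kP.
(* The cone of V -> P is quasi-isomorphic to P/V ~ X in degree 0. *)
have hz : hom_zero (Q (aug dk)) (Q (shift_ob (stalk_ob V))).
  apply: (hom_zero_iso (iso_sym (trunc_iso (fun n => @aug_acyclic _ _ _ _ _ dk n km)))
    (fiso_iso (stalk_ob V : cplx_cat H) (dshiftQ D))).
  apply: nonneg_hom_zero => //; first exact: trunc_nonneg.
  case=> [|j]; last by move=> u; apply: zero_dom; apply/zero_incl/zero_obP.
  apply: (hom_zero_iso _ (iso_refl _) (X0 V)); apply: fmap_iso.
  exact: (cokernel_unique kq (trunc_projP (aug dk))).
have [r] := aug_retract (@stalk_nonneg _ _ P) sh_fa sh_fu (hz _).
have -> : coaug dk = stalk_map k by apply: chain_eq => -[[|n]|n].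
have [r0 <-] := incl_full (r : mor (incl P) (incl V)).
move=> rk; have r0k : r0 \oc k = idm V.
  by apply: (faithful_inj (@incl_faithful _ _ D)); rewrite fmapM fmap1 -[RHS]rk.
have [|t tP] := cokernel_desc (u := idm P - k \oc r0) kq.
  by rewrite compDl compNl comp1m -compA r0k compm1 subrr.
have qt : q \oc t = idm X.
  apply: qe; rewrite -compA tP compDr compNr compm1 compA (proj1 kP) comp0m subr0.
  by rewrite comp1m.
by exists (f' \oc t); rewrite compA qP -compA qt compm1.
Qed.

(* H^0(C) = ker d^0 is a direct summand of C, since the cone of its inclusion has
   no maps to H[1]. *)
Lemma heart_dichotomy (Z : D) : hereditary D -> coconnective Z ->
  (forall e : mor Z Z, e \oc e = e -> e = 0 \/ e = idm Z) ->
  (exists Y : H, iso (incl Y) Z) \/ (forall V : H, hom_zero (incl V) Z).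
Proof.
move=> [Ext0 _ _] /coconnective_nonneg[C C0 CZ] idem.
have [Y [k kP]] := ab_ker (cd C 0); have dk := proj1 kP.
have hz : hom_zero (Q (aug dk)) (Q (shift_ob (stalk_ob Y))).
  apply: (fmap_hom_zero sh_fa).
  apply: (hom_zero_iso _ (iter_shift_iso 1 (fiso_iso (stalk_ob Y : cplx_cat H) (dshiftQ D)))
    (nonneg_hom_zero (W := iter 2 sh (incl Y)) sh_fa (trunc_nonneg (shift_ob (aug dk))) _)).
    apply: iso_sym.
    apply: (iso_trans _ (trunc_iso (fun n => @aug_shift_acyclic _ _ _ _ _ dk n kP))).
    exact: (fiso_iso (aug dk : cplx_cat H) (dshiftQ D)).
  by move=> j e; rewrite -iterD in e *; apply: Ext0; rewrite leq_addl.
have [r rP] := aug_retract C0 sh_fa sh_fu (hz _).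
set i := fmap Q _ in rP; have [a [b [ba ab]]] := CZ.
pose e := a \oc i \oc r \oc b.
have ee : e \oc e = e.
  rewrite /e -!compA (compA b) ba comp1m (compA r) rP comp1m //.
have eE : i \oc r = b \oc e \oc a.
  by rewrite /e !compA ba comp1m -!compA ba compm1.
have [e0|e1] := idem e ee; last first.
  left; exists Y; apply: iso_trans CZ; exists i, r; split=> //.
  by rewrite eE e1 compm1 ba.
(* Now H^0(C) = 0. A map from V is a fraction into a nonnegative W whose degree 0 cycles come, on a
   cover, from cycles of C^0, hence vanish. *)
right=> V; apply: (hom_zero_iso (iso_refl _) CZ) => g.
have Y0 : is_zero Y.
  rewrite /is_zero; apply: (@incl_faithful _ _ D); rewrite fmap1 -[LHS]rP.
  by rewrite -[r]comp1m -rP -!compA (compA i) eE e0 compm0 !comp0m compm0.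
have [W [f [s [W0 sq sg]]]] := roof_nonneg g C0.
apply: (mono_zero (is_iso_mono (qis_iso D sq))); rewrite sg.
rewrite (_ : f = 0) ?fmap0 //; apply: chain_eq.
have /quasi_isoP[_ ss] := sq.
case=> [[|n]|n]; [|by apply: zero_dom; apply: zero_obP|by apply: zero_dom; apply: zero_obP].
pose f0 : mor V ((W : cplx H) 0) := (f : chain _ _) 0.
have df0 : cd (W : cplx H) (Negz 0 + 1) \oc f0 = 0.
  by rewrite [LHS](chain_comm (f : chain _ _) 0) compm0.
have [V' [e' [x [w [e'e dx xP]]]]] := ss (Negz 0) V f0 df0.
have [x' x'P] := kernel_lift kP dx.
apply: (epi_zero e'e); rewrite -[LHS]xP -x'P (zero_cod x' Y0) !compm0 add0r.
by rewrite (zero_cod w (W0 0%N)) compm0.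
Qed.

End Heart.

(** * The Auslander-Reiten translation and the orbit algebra *)

Section LinIso.
Variable K : fieldType.
Implicit Types U V W : lmodType K.

Lemma inj_surj_bij (A B : Type) (f : A -> B) :
  injective f -> (forall y, exists x, f x = y) -> bijective f.
Proof.
move=> fi fs; exists (fun y => sval (cid (fs y))) => [x|y].
  exact/fi/(svalP (cid (fs (f x)))).
exact: svalP (cid (fs y)).
Qed.

Definition lin_iso V W : Prop := exists f : V -> W, linear f /\ bijective f.

Lemma can_linear V W (f : V -> W) (g : W -> V) :
  linear f -> cancel f g -> cancel g f -> linear g.
Proof. by move=> fl fg gf a u v; apply: (can_inj fg); rewrite fl !gf. Qed.

Lemma lin_iso_sym V W : lin_iso V W -> lin_iso W V.
Proof.
by move=> [f [fl [g fg gf]]]; exists g; split; [apply: can_linear fg gf | exists f].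
Qed.

Lemma lin_iso_trans U V W : lin_iso U V -> lin_iso V W -> lin_iso U W.
Proof.
move=> [f [fl fb]] [g [gl gb]]; exists (g \o f)%FUN; split; last exact: bij_comp.
by move=> a u v; rewrite /= fl gl.
Qed.

Lemma lin_iso_prod V V' W W' :
  lin_iso V V' -> lin_iso W W' -> lin_iso (V * W)%type (V' * W')%type.
Proof.
move=> [f [fl [f' ff' f'f]]] [g [gl [g' gg' g'g]]].
exists (fun x => (f x.1, g x.2)); split.
  by move=> a [u1 u2] [v1 v2]; rewrite /= fl gl.
by exists (fun x => (f' x.1, g' x.2)) => -[x y] /=; rewrite ?ff' ?gg' ?f'f ?g'g.
Qed.

Lemma lin_iso_hom_zero (C C' : lincat K) (X Y : C) (X' Y' : C') :
  hom_zero X Y -> hom_zero X' Y' -> lin_iso (mor X Y) (mor X' Y').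
Proof.
move=> h h'; exists (fun _ => 0); split; first by move=> a u v; rewrite scaler0 addr0.
by exists (fun _ => 0) => f; [rewrite (h f) | rewrite (h' f)].
Qed.

Lemma lin_iso_mor (C : lincat K) (V X Y : C) : iso X Y -> lin_iso (mor V X) (mor V Y).
Proof.
move=> [f [g [gf fg]]]; exists (fun u => f \oc u); split; first exact: comp_linearr.
by exists (fun u => g \oc u) => u; rewrite compA ?gf ?fg comp1m.
Qed.

Lemma lin_iso_sum (C : lincat K) (V X Y Z : C) :
  is_sum X Y Z -> lin_iso (mor V Z) (mor V X * mor V Y)%type.
Proof.
move=> [i [j [p [q [pi qj pj qi ij]]]]].
exists (fun u => (p \oc u, q \oc u)); split.
  by move=> a u v; rewrite !compDr !compZr.
exists (fun x => i \oc x.1 + j \oc x.2) => [u|[x y]] /=.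
  by rewrite !compA -compDl ij comp1m.
by rewrite !compDr !compA pi pj qi qj !comp0m !comp1m addr0 add0r.
Qed.

End LinIso.

Lemma transport_bimod (R : pzRingType) (A : alg R) (M N : lmodType R)
    (B : bimod A N) (t : M -> N) : linear t -> bijective t ->
  exists B' : bimod A M, (forall a m, t (lact B' a m) = lact B a (t m)) /\
    (forall m a, t (ract B' m a) = ract B (t m) a).
Proof.
move=> tl [s ts st].
have sl : linear s by move=> a u v; apply: (can_inj ts); rewrite tl !st.
pose l a m := s (lact B a (t m)); pose r m a := s (ract B (t m) a).
have l1 m : linear (fun a => l a m) by move=> a u v; rewrite /l lact_linearl sl.
have l2 a : linear (l a) by move=> c u v; rewrite /l tl lact_linearr sl.
have r1 a : linear (fun m => r m a) by move=> c u v; rewrite /r tl ract_linearl sl.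
have r2 m : linear (r m) by move=> c u v; rewrite /r ract_linearr sl.
have l3 m : l aone m = m by rewrite /l lact1 ts.
have r3 m : r m aone = m by rewrite /r ract1 ts.
have l4 a b m : l (amul a b) m = l a (l b m) by rewrite /l st lactM.
have r4 a b m : r m (amul a b) = r (r m a) b by rewrite /r st ractM.
have lr a m b : r (l a m) b = l a (r m b) by rewrite /r /l !st lractA.
by exists (Bimod l1 l2 r1 r2 l3 r3 l4 r4 lr); split=> [a m|m a]; apply: st.
Qed.

(** * Decomposition into indecomposable objects *)

Section Decomposition.
Variables (K : fieldType) (C : lincat K).
Implicit Types X Y Z : C.

Lemma is_sum_sym X Y Z : is_sum X Y Z -> is_sum Y X Z.
Proof.
by move=> [i [j [p [q [pi qj pj qi ij]]]]]; exists j, i, q, p; rewrite addrC.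
Qed.

(** End X is a quotient of End Z in which the nonzero idempotent projecting onto Y dies. *)
Lemma spanned_summand n X Y Z : is_sum X Y Z -> ~ is_zero Y ->
  spanned n (mor Z Z) -> exists2 m, (m < n)%N & spanned m (mor X X).
Proof.
move=> [i [j [p [q [pi qj pj qi ij]]]]] Y0.
apply: (@spanned_quotient _ _ _ _ (fun f => p \oc f \oc i) (j \oc q)).
- by move=> a u v; rewrite compDr compZr compDl compZl.
- by move=> f; exists (i \oc f \oc p); rewrite !compA pi comp1m -compA pi compm1.
- apply/eqP => jq; apply: Y0; have : (q \oc j) \oc (q \oc j) = 0.
    by rewrite -compA (compA j) jq comp0m compm0.
  by rewrite qj comp1m.
by rewrite !compA pj !comp0m.
Qed.

(** The existence half of Krull-Schmidt as an induction principle, by descent on the dimension of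
    End. *)
Lemma sum_ind (P : C -> Prop) : (forall X, findim (mor X X)) ->
  (forall X, is_zero X -> P X) -> (forall X, indecomposable X -> P X) ->
  (forall X Y Z, is_sum X Y Z -> P X -> P Y -> P Z) -> forall X, P X.
Proof.
move=> fd P0 Pi Ps X; have [n] := fd X.
elim/ltn_ind: n X => n IHn X nX.
have [X0|X0] := pselect (is_zero X); first exact: P0.
have [Xi|] := pselect (indecomposable X); first exact: Pi.
move=> /not_andP[//|/existsNP[Y /existsNP[Z /not_implyP[YZX /not_orP[Y0 Z0]]]]].
have [m mn mY] := spanned_summand YZX Z0 nX.
have [l ln lZ] := spanned_summand (is_sum_sym YZX) Y0 nX.
by apply: Ps YZX _ _; [apply: IHn mY | apply: IHn lZ].
Qed.

Lemma sum_self_zero X : findim (mor X X) -> is_sum X X X -> is_zero X.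
Proof.
move=> [n nX] XX; apply: contrapT => X0.
elim/ltn_ind: n nX => n IHn nX.
by have [m mn /(IHn m mn)] := spanned_summand XX X0 nX.
Qed.

Lemma zero_is_sum X : is_zero X -> is_sum X X X.
Proof. by move=> X0; exists 0, 0, 0, 0; rewrite comp0m addr0; split=> //; rewrite X0. Qed.

End Decomposition.

(** * Vanishing outside degrees 0 and 1, and comparison of tau with tau_H *)

Section Translation.
Variables (K : fieldType) (H : abcat K) (D : derived_cat H) (tau : ar_translation D).
Local Notation sh := (dshift D).
Local Notation incl := (incl D).
Implicit Types (V X Y : H) (Z W : D).

Lemma dshift_faithful : faithful sh.
Proof. exact: (sh_faithful (tau_serre tau)). Qed.

Lemma dshift_full : full sh.
Proof. exact: (sh_full (tau_serre tau)). Qed.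

Lemma serre_vanish Z W : hom_zero W (tau (sh Z)) <-> hom_zero Z W.
Proof. exact: (serre_hom_zero (tau_serre tau)). Qed.

Lemma tau_dshift Z : iso (tau (sh Z)) (sh (tau Z)).
Proof. exact: (fiso_iso Z (tau_shift_comm (tau_serre tau))). Qed.

Definition coconnective1 Z : Prop :=
  forall V n, hom_zero (iter n sh (incl V)) Z.

Lemma coconnective1W Z : coconnective1 Z -> coconnective Z.
Proof. by move=> Z1 V n; apply: Z1. Qed.

Lemma coconnective1_iso Z W : iso Z W -> coconnective1 Z -> coconnective1 W.
Proof. by move=> ZW Z0 V n; apply: hom_zero_iso (Z0 V n) => //; apply: iso_refl. Qed.

Lemma coconnective_sh Z : coconnective (sh Z) <-> coconnective1 Z.
Proof.
split=> Z0 V n; first exact/(fmap_hom_zero dshift_faithful)/(Z0 V n).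
exact/(full_hom_zero dshift_full)/(Z0 V n).
Qed.

Hypothesis hH : hereditary D.

Lemma tau_coconnective Z : coconnective Z -> coconnective (tau Z).
Proof.
(* One more shift turns tau Z into S Z and V[n + 1] into V[n + 2]: hence the bound 2. *)
move=> Z0 V n; apply: (fmap_hom_zero dshift_faithful).
apply: (hom_zero_iso (iso_refl _) (tau_dshift Z)).
apply/serre_vanish; exact: (@coconnective_hom_zero _ _ _ dshift_faithful _ V n.+2 hH).
Qed.

Lemma tau_coconnective1 Z : coconnective1 Z -> coconnective1 (tau Z).
Proof.
move=> /coconnective_sh/tau_coconnective Z0.
exact/coconnective_sh/(coconnective_iso (tau_dshift Z)).
Qed.

Section Powers.
Variable P : int_powers (cluster_functor tau).

Lemma pw0_iso Z : iso (pw P 0 Z) Z.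
Proof. by apply: iso_sym; exists (pw_eps P Z); apply: pw_eps_iso. Qed.

Lemma pwD_iso i j k Z : i + j = k -> iso (pw P i (pw P j Z)) (pw P k Z).
Proof. by move=> e; exists (pw_mu P e Z); apply: pw_mu_iso. Qed.

(** F^-1 = tau [-1], stated without an inverse of [1]: with W = F^-1 Z, both sides are tau (F W). *)
Lemma sh_pwN1 Z : iso (sh (pw P (-1) Z)) (tau Z).
Proof.
set W := pw P (-1) Z.
apply: (@iso_trans _ _ _ (tau (ae_inv tau (sh W)))).
  exact/iso_sym/(fiso_iso (sh W) (ae_counit tau)).
apply: fmap_iso; apply: (@iso_trans _ _ _ (pw P 1 W)).
  exact/iso_sym/(fiso_iso W (pw1 P)).
by apply: iso_trans (pw0_iso Z); apply: pwD_iso.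
Qed.

Lemma pwN1_coconnective1 Z : coconnective Z -> coconnective1 (pw P (-1) Z).
Proof.
move=> Z0; apply/coconnective_sh/(coconnective_iso (iso_sym (sh_pwN1 Z))).
exact: tau_coconnective.
Qed.

Lemma pw_neg_coconnective1 n Z : coconnective Z -> coconnective1 (pw P (Negz n) Z).
Proof.
move=> Z0; elim: n => [|n IHn]; first exact: pwN1_coconnective1.
have e : -1 + Negz n = Negz n.+1 by lia.
apply: (coconnective1_iso (pwD_iso Z e)).
exact/pwN1_coconnective1/coconnective1W.
Qed.

(** F^-1 S is tau^2, since the [-1] of F^-1 cancels the [1] of S. *)
Lemma pwN1_serre_coconnective Z :
  coconnective Z -> coconnective (pw P (-1) (tau (sh Z))).
Proof.
move=> Z0 V n; apply: (fmap_hom_zero dshift_faithful).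
apply: (hom_zero_iso (X := sh (iter n.+1 sh (incl V))) (Y := sh (tau (tau Z)))).
- exact: iso_refl.
- apply/iso_sym/(iso_trans (sh_pwN1 _)).
  exact: iso_trans (fmap_iso tau (tau_dshift Z)) (tau_dshift _).
exact/(full_hom_zero dshift_full)/tau_coconnective/tau_coconnective.
Qed.

Lemma pw_hom_zero i j Z W : i + j = 0 -> hom_zero Z (pw P j W) -> hom_zero (pw P i Z) W.
Proof.
move=> e h f; have e' : j + i = 0 by rewrite addrC.
have jf : fmap (pw P j) f = 0.
  apply: (hom_zero_iso (iso_sym (iso_trans (pwD_iso Z e') (pw0_iso Z))) (iso_refl _) h).
have f0 : fmap (pw P 0) f = 0.
  apply: (epi_zero (is_iso_epi (pw_mu_iso P e (pw P i Z)))).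
  by rewrite -[LHS](pw_mu_nat P e f) /= jf fmap0 compm0.
apply: (mono_zero (is_iso_mono (pw_eps_iso P W))).
by rewrite [LHS](pw_eps_nat P f) f0 comp0m.
Qed.

Lemma pw_vanish V i : i != 0 -> i != 1 -> hom_zero (incl V) (pw P i (incl V)).
Proof.
have V0 := @incl_coconnective _ _ D V.
case: i => [[|[|n]]|n] // _ _; last exact: (@pw_neg_coconnective1 n _ V0 V 0%N).
(* Here i = n + 2 and F^-i = F^-(n+1) F^-1: the factor F^-1 absorbs S, and a negative power
   remains. *)
apply/serre_vanish; have e : Posz n.+2 + Negz n.+1 = 0 by lia.
apply: (pw_hom_zero e); have e' : Negz n + (-1) = Negz n.+1 by lia.
apply: (hom_zero_iso (iso_refl _) (pwD_iso _ e')).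
exact: (@pw_neg_coconnective1 n _ (pwN1_serre_coconnective V0) V 0%N).
Qed.

End Powers.

Lemma indecomposable_idem X (e : mor (tau (incl X)) (tau (incl X))) :
  indecomposable X -> e \oc e = e -> e = 0 \/ e = idm _.
Proof.
move=> [_ Xi]; have [e1 <-] := ae_full e; have [e0 <-] := incl_full e1.
rewrite -!fmapM => /(faithful_inj (@ae_faithful _ _ tau)).
move=> /(faithful_inj (@incl_faithful _ _ D)) /idem_split.
move=> [Y [Z [i [j [p [q [S ipe]]]]]]].
have /Xi[Y0|Z0] : is_sum Y Z X by exists i, j, p, q.
  by left; rewrite -ipe (zero_cod p Y0) compm0 !fmap0.
right; have [_ _ _ _] := S; rewrite (zero_cod q Z0) compm0 addr0 ipe => ->.
by rewrite !fmap1.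
Qed.

Variable tauH : H -> H.
Hypothesis htauH : is_ar_translation_on tau tauH.

(* The hypotheses on tauH determine it on zero objects only through additivity. *)
Lemma tauH_zero X : is_zero X -> is_zero (tauH X).
Proof.
have [_ tS _ _] := htauH; have [_ fd _] := hH.
by move=> /zero_is_sum/tS; apply: sum_self_zero.
Qed.

Lemma tauH_indecomposable X : indecomposable X ->
  iso (incl (tauH X)) (tau (incl X))
  \/ is_zero (tauH X) /\ coconnective1 (tau (incl X)).
Proof.
move=> Xi; have [_ _ tP tI] := htauH.
have tX := tau_coconnective (@incl_coconnective _ _ D X).
have [[Y YX]|X1] := heart_dichotomy dshift_faithful dshift_full hH tX
  (fun e => @indecomposable_idem X e Xi).
  by left; apply: (iso_trans _ YX); apply: fmap_iso; apply: tI YX.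
right; split; last by move=> V [|n]; (apply: X1 || apply: tX).
(* Ext^1(X, V) is dual to Hom(V, tau X), which vanishes. *)
apply: (tP X Xi); apply: (ext1_projective dshift_faithful dshift_full) => V.
apply/serre_vanish; apply: (hom_zero_iso (iso_refl _) (iso_sym (tau_dshift _))).
exact/(full_hom_zero dshift_full)/X1.
Qed.

Lemma tauH_mor V X : lin_iso (mor V (tauH X)) (mor (incl V) (tau (incl X))).
Proof.
have [_ tS _ _] := htauH; have [_ fd _] := hH.
elim/sum_ind: X => [//|X X0|X Xi|X Y Z XYZ PX PY].
- apply: lin_iso_hom_zero => u; apply: zero_cod; first exact: tauH_zero.
  by rewrite /is_zero -!fmap1 X0 !fmap0.
- have [tX|[X0 X1]] := tauH_indecomposable Xi.
    apply: lin_iso_trans (lin_iso_mor _ tX).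
    exists (fmap incl); split; first exact: fmap_linear.
    apply: inj_surj_bij; last exact: incl_full.
    by move=> f g; apply/faithful_inj/incl_faithful.
  apply: lin_iso_hom_zero; last exact: (X1 V 0%N).
  by move=> u; apply: zero_cod.
have S1 := fmap_is_sum tau (fmap_is_sum incl XYZ).
apply: lin_iso_trans (lin_iso_sum _ (tS _ _ _ XYZ)) _.
exact: lin_iso_trans (lin_iso_prod PX PY) (lin_iso_sym (lin_iso_sum _ S1)).
Qed.

(** Once tau X has left H it lies in D^(>=1), and so does tau^2 X; it cannot come back to H, so both
    sides vanish. *)
Lemma tauH2_mor V X :
  lin_iso (mor V (tauH (tauH X))) (mor (incl V) (tau (tau (incl X)))).
Proof.
have [_ tS _ _] := htauH; have [_ fd _] := hH.
elim/sum_ind: X => [//|X X0|X Xi|X Y Z XYZ PX PY].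
- apply: lin_iso_hom_zero => u; apply: zero_cod; first exact/tauH_zero/tauH_zero.
  by rewrite /is_zero -!fmap1 X0 !fmap0.
- have [tX|[X0 X1]] := tauH_indecomposable Xi.
    exact: lin_iso_trans (tauH_mor V (tauH X)) (lin_iso_mor _ (fmap_iso tau tX)).
  apply: lin_iso_hom_zero; last exact: (@tau_coconnective1 _ X1 V 0%N).
  by move=> u; apply/zero_cod/tauH_zero.
have S1 := fmap_is_sum tau (fmap_is_sum tau (fmap_is_sum incl XYZ)).
apply: lin_iso_trans (lin_iso_sum _ (tS _ _ _ (tS _ _ _ XYZ))) _.
exact: lin_iso_trans (lin_iso_prod PX PY) (lin_iso_sym (lin_iso_sum _ S1)).
Qed.

End Translation.

(** * The orbit algebra when only degrees 0 and 1 survive *)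

Section OrbitAlgebra.
Variables (K : fieldType) (C : lincat K) (F : functor C C) (P : int_powers F) (X : C).
Hypothesis van : forall i, i != 0 -> i != 1 -> hom_zero X (pw P i X).
Implicit Types x y : orbit_hom P X X.

Lemma orbit_comp01 x y k : orbit_comp x y k
  = hcomp (int_split 0 k) (x (k - 0)) (y 0) + hcomp (int_split 1 k) (x (k - 1)) (y 1).
Proof.
have y0 i : i \notin [:: 0; 1] -> y i = 0.
  by rewrite !inE negb_or => /andP[i0 i1]; apply: van.
by rewrite [LHS](orbit_comp_seq x k _ y0) // big_cons big_seq1.
Qed.

Lemma orbit_comp_at0 x y (a b : mor X X) :
  x 0 = pw_eps P X \oc a -> y 0 = pw_eps P X \oc b ->
  orbit_comp x y 0 = pw_eps P X \oc (a \oc b).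
Proof.
move=> xa yb; rewrite orbit_comp01 [x (0 - 1)]van // hcomp0m addr0.
rewrite (hcomp_eq _ (addr0 0) x) /hcomp xa yb fmapM !compA pw_mur1 comp1m.
by rewrite -(pw_eps_nat P a).
Qed.

Lemma orbit_comp_at1 x y (a b : mor X X) :
  x 0 = pw_eps P X \oc a -> y 0 = pw_eps P X \oc b ->
  orbit_comp x y 1 = fmap (pw P 1) a \oc y 1 + x 1 \oc b.
Proof.
move=> xa yb; rewrite orbit_comp01 addrC; congr (_ + _).
  rewrite (hcomp_eq _ (addr0 1) x) /hcomp xa fmapM compA pw_mur1.
  by rewrite comp1m.
rewrite (hcomp_eq _ (add0r 1) x) /hcomp yb compA -(compA _ _ (pw_eps P X)).
by rewrite -(pw_eps_nat P (x 1)) (compA _ (pw_eps P _)) pw_mul1 comp1m.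
Qed.

End OrbitAlgebra.

Theorem proposition3p1 (K : fieldType) (H : abcat K) (D : derived_cat H)
    (tau : ar_translation D) (P : int_powers (cluster_functor tau))
    (tauH : H -> H) (T : H)
    (hH : hereditary D) (htauH : is_ar_translation_on tau tauH)
    (hT : tilting D T) (bT : basic T) :
  exists M : bimod (end_alg T) (mor T (tauH (tauH T))),
    bimod_iso M (hom_bimod (incl D) (fcomp tau (fcomp tau (incl D))) T) /\
    alg_iso (end_alg (incl D T : cluster_cat P)) (trivext (dual_bimod M)).
Proof.
pose B := hom_bimod (incl D) (fcomp tau (fcomp tau (incl D))) T.
have [t [tl tb]] := tauH2_mor hH htauH T T.
have [M [Ml Mr]] := transport_bimod B tl tb.
exists M; split; first by exists t; split.
have [Phi [Pl Pb P_l P_r]] := serre_dual_bimod (tau_serre tau) (incl D T).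
have [u [un ui]] := pw1 P.
set X := incl D T in Phi Pl Pb P_l P_r *.
have ts f : scalar (fun m => Phi (u X \oc f) (t m)).
  by move=> a v w; rewrite tl dual_scalar.
(* [u] identifies F^1 with tau^-1 [1], [Phi] is the duality, and [t] replaces tau^2 by tau_H^2. *)
pose be f : dual (mor T (tauH (tauH T))) := dual_mk (ts f).
have bel : linear be.
  move=> a v w; apply: dual_eq => m; rewrite dualDE dualZE.
  by rewrite -[LHS]/(Phi _ _) compDr compZr Pl dualDE dualZE.
have [s st ts'] := tb; have sl := can_linear tl st ts'.
have [Phi' PhiK Phi'K] := Pb; have [u' [u'u uu']] := ui X.
have beI : injective be.
  move=> f g fg; apply: (is_iso_mono (ui X)); apply: (can_inj PhiK).
  apply: dual_eq => m; rewrite -(ts' m); exact: (congr1 (fun q => dual_fun q (s m)) fg).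
have beS p : exists f, be f = p.
  have ps : scalar (fun m => p (s m)) by move=> a v w; rewrite sl dual_scalar.
  exists (u' \oc Phi' (dual_mk ps)); apply: dual_eq => m.
  by rewrite -[LHS]/(Phi _ _) compA uu' comp1m Phi'K /dual_fun /= st.
have [e [e_eps eps_e]] := pw_eps_iso P X.
have alex (f : mor X (pw P 0 X)) : exists a : mor T T, pw_eps P X \oc fmap (incl D) a = f.
  have [a aE] := incl_full (e \oc f : mor (incl D T) (incl D T)).
  by exists a; rewrite aE compA eps_e comp1m.
have alI (a b : mor T T) :
    pw_eps P X \oc fmap (incl D) a = pw_eps P X \oc fmap (incl D) b -> a = b.
  move=> /(is_iso_mono (pw_eps_iso P X)); exact/faithful_inj/incl_faithful.
(* The degree 0 part is read as an endomorphism of T through 1 ~ F^0 and full faithfulness of the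
   inclusion. *)
pose al f := sval (cid (alex f)).
have alP f : pw_eps P X \oc fmap (incl D) (al f) = f := svalP (cid (alex f)).
have all : linear al.
  by move=> a v w; apply: alI; rewrite fmapD fmapZ compDr compZr !alP.
have van := @pw_vanish _ _ _ tau hH P T.
pose Psi (x : orbit_hom P X X) : trivext (dual_bimod M) := (al (x 0), be (x 1)).
exists Psi; split.
- by move=> a x y; rewrite /Psi [al _]all [be _]bel.
- apply: inj_surj_bij => [x y xy|[a p]].
    have /= xy0 := congr1 fst xy; have /= /beI xy1 := congr1 snd xy.
    apply: orbit_eq => i.
    have [->|i0] := eqVneq i 0; first by rewrite -[LHS]alP xy0 alP.
    have [->//|i1] := eqVneq i 1; by rewrite [LHS]van // [RHS]van.
  have [f fp] := beS p.
  pose xf (i : int) : mor X (pw P i X) :=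
    match i with
    | Posz 0 => pw_eps P X \oc fmap (incl D) a | Posz 1 => f | _ => 0
    end.
  have xs : exists r : seq int, forall i, i \notin r -> xf i = 0.
    by exists [:: 0; 1] => -[[|[|i]]|i].
  exists (orbit_mk xs); congr pair; last exact: fp.
  by apply: alI; rewrite alP.
- have be0 : be 0 = 0.
    apply: dual_eq => m; rewrite -[LHS]/(Phi _ _) compm0.
    have -> : Phi 0 = 0.
      by apply: (addrI (Phi 0)); rewrite -{1}[Phi 0]scale1r -Pl scale1r !addr0.
    by [].
  congr pair; last exact: be0.
  by apply: alI; rewrite alP fmap1 compm1.
move=> x y; have x0 := esym (alP (x 0)); have y0 := esym (alP (y 0)).
congr pair; first by apply: alI; rewrite alP fmapM; apply: (orbit_comp_at0 van x0 y0).
have beM : be (orbit_comp x y 1)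
    = dual_lact M (al (x 0)) (be (y 1)) + dual_ract M (be (x 1)) (al (y 0)).
  rewrite (orbit_comp_at1 van x0 y0) -[X in be (X + _)]scale1r bel scale1r.
  congr (_ + _); apply: dual_eq => m.
    (* Naturality of [u] carries F^1 a to tau^-1 (a[1]), and [Phi] moves it to the right of the
       argument, as the left action on a dual demands. *)
    rewrite -[LHS]/(Phi _ _) -[RHS]/(Phi (u X \oc y 1) (t (ract M m (al (x 0))))).
    rewrite compA un Mr -compA; exact: P_l.
  rewrite -[LHS]/(Phi _ _) -[RHS]/(Phi (u X \oc x 1) (t (lact M (al (y 0)) m))).
  rewrite compA Ml; exact: P_r.
exact: beM.
Qed.
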